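(* Let $T_+$ be an $(n+1)$-periodic and $(2m+1)$-banded Toeplitz operator acting on $\ell^2(\mathbb{N}_0)$, where $n,m\in\mathbb{N}_0$. Then there exists a nonzero real polynomial $g(x,y)\in\mathbb{R}[x,y]$ in two variables such that if $(x,y)\in\partial W(T_+)$, then $g(x,y)=0$.
   Context: $\mathbb{N}_0$ denotes the nonnegative integers. For a bounded operator $A$, $W(A)=\{\langle Ax,x\rangle : \|x\|=1\}$ is its numerical range; $\mathbb{C}$ is identified with $\mathbb{R}^2$ via $x+iy\leftrightarrow(x,y)$, and $\partial$ denotes the topological boundary in $\mathbb{R}^2$. Periodic banded Toeplitz operators: for each $r=-m,\dots,0,\dots,m$ let $a^{(r)}=(a^{(r)}_j)_{j\in\mathbb{Z}}$ be a complex bi-infinite sequence that is $(n+1)$-periodic, i.e. $a^{(r)}_{j+n+1}=a^{(r)}_j$ for all $j\in\mathbb{Z}$; put $a^{(r)}_j=0$ for all $j$ if $|r|>m$. The $(n+1)$-periodic and $(2m+1)$-banded Toeplitz operator $T_+$ on $\ell^2(\mathbb{N}_0)$ defined by these sequences is the bounded operator with matrix entries $\langle T_+ e_k,e_j\rangle=a^{(k-j)}_j$ for $j,k\in\mathbb{N}_0$ (with $(e_k)$ the canonical basis). *)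

(* Defs.v *)
From HB Require Import structures.
From mathcomp Require Import all_boot all_order all_algebra.
From mathcomp Require Import all_classical all_reals all_analysis.
From mathcomp Require Export complex.
From mathcomp Require Import ring lra.

Set Implicit Arguments.
Unset Strict Implicit.
Unset Printing Implicit Defensive.

Import Order.TTheory GRing.Theory Num.Theory numFieldNormedType.Exports.
Local Open Scope classical_set_scope.
Local Open Scope ring_scope.
Local Open Scope complex_scope.

Section SquareSummable.
Context {R : realType}.

(* [|z|] in [R[i]] is a complex number with zero imaginary part; [sqnormc z] is
   its square, as an element of R. *)
Definition sqnormc (z : R[i]) : R := complex.Re z ^+ 2 + complex.Im z ^+ 2.

Definition square_summable (x : nat -> R[i]) : Prop :=
  cvgn (series (fun k => sqnormc (x k))).

Definition l2_pred : {pred nat -> R[i]} := mem [set x | square_summable x].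

Lemma sqnormc_ge0 z : 0 <= sqnormc z.
Proof. by rewrite /sqnormc addr_ge0 ?sqr_ge0. Qed.

Lemma sqnormcE (z : R[i]) : (sqnormc z)%:C = `|z| ^+ 2.
Proof. exact: add_Re2_Im2. Qed.

Lemma sqnormc_lin (a u v : R[i]) :
  sqnormc (a * u + v) <= 2 * sqnormc a * sqnormc u + 2 * sqnormc v.
Proof.
rewrite /sqnormc; case: a u v => [a b] [u u'] [v v'] /=.
rewrite -subr_ge0.
have := sqr_ge0 (a * u - b * u' - v); have := sqr_ge0 (a * u' + b * u - v').
lra.
Qed.

Lemma l2_submod_closed : submod_closed l2_pred.
Proof.
split; first apply/mem_set.
  rewrite /= /square_summable; apply: (is_cvg_near_cst (0 : R)).
  near=> n; rewrite /series/= big1// => i _.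
  by rewrite /sqnormc/= expr0n addr0.
move=> a x y /set_mem xl /set_mem yl; apply/mem_set => /=.
pose v : R^nat := (2 * sqnormc a) *: (fun k => sqnormc (x k) : R) +
  2 *: (fun k => sqnormc (y k) : R).
apply: (@series_le_cvg _ _ v) => [k|k|k|].
- exact: sqnormc_ge0.
- by rewrite addr_ge0// mulr_ge0 ?mulr_ge0 ?sqnormc_ge0.
- exact: sqnormc_lin.
- by apply: is_cvg_seriesD; apply: is_cvg_seriesZ.
Unshelve. all: by end_near. Qed.

HB.instance Definition _ :=
  GRing.isSubmodClosed.Build R[i] (nat -> R[i]) l2_pred l2_submod_closed.

End SquareSummable.

Record l2 (R : realType) := L2
  { l2_seq :> nat -> R[i] ; _ : l2_seq \in l2_pred }.

HB.instance Definition _ (R : realType) := [isSub for @l2_seq R].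
HB.instance Definition _ (R : realType) := [Choice of l2 R by <:].
HB.instance Definition _ (R : realType) :=
  [SubChoice_isSubLmodule of l2 R by <:].

Section Operators.
Context {R : realType}.
Implicit Types (x y : l2 R) (T : l2 R -> l2 R).

Lemma l2_basis_subproof (k : nat) :
  (fun j : nat => (j == k)%:R : R[i]) \in l2_pred.
Proof.
apply/mem_set; rewrite /= /square_summable.
apply: (is_cvg_near_cst (1 : R)); near=> n.
have kn : (k < n)%N by near: n; exists k.+1.
rewrite /series/= (bigD1_seq k) ?mem_index_iota ?iota_uniq//=.
rewrite eqxx /sqnormc/= expr0n expr1n addr0 big1 ?addr0// => i /negbTE ->.
by rewrite /= expr0n addr0.
Unshelve. all: by end_near. Qed.

Definition l2_basis (k : nat) : l2 R := L2 (l2_basis_subproof k).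

Definition l2_dot x y : R[i] :=
  limn (series (fun k => x k * (y k)^* : R[i]^o)).

Definition l2_norm x : R :=
  Num.sqrt (limn (series (fun k => sqnormc (x k)))).

Definition bounded_operator T : Prop :=
  exists M : R, forall x, l2_norm (T x) <= M * l2_norm x.

Definition numerical_range T : set R[i] :=
  [set z | exists2 x, l2_norm x = 1 & z = l2_dot (T x) x].

Definition plane_set (A : set R[i]) : set (R * R) :=
  [set p | A (p.1 +i* p.2)].

(* [a r j] is the j-th entry of the bi-infinite sequence attached to the r-th
   diagonal. *)
Definition periodic_banded (n m : nat) (a : int -> int -> R[i]) : Prop :=
  (forall r j, a r (j + n.+1%:Z) = a r j) /\
  (forall r j, m%:Z < `|r| -> a r j = 0).

Definition toeplitz_entries (a : int -> int -> R[i]) T : Prop :=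
  forall j k : nat,
    l2_dot (T (l2_basis k)) (l2_basis j) = a (k%:Z - j%:Z) j%:Z.

Definition periodic_banded_toeplitz (n m : nat) T : Prop :=
  exists2 a, periodic_banded n m a & toeplitz_entries a T.

End Operators.

Definition boundary (X : topologicalType) (A : set X) : set X :=
  closure A `\` interior A.

(* Main.v *)
Require Import Defs.
From HB Require Import structures.
From mathcomp Require Import all_boot all_order all_algebra.
From mathcomp Require Import all_classical all_reals all_analysis.
From mathcomp Require Import cyclic separable cyclotomic polyrcf polyXY ring lra zify.
Import Order.TTheory GRing.Theory Num.Theory numFieldNormedType.Exports.
Local Open Scope classical_set_scope.
Local Open Scope ring_scope.

(* Shifting a finitely supported vector by a large multiple of the period changes
   neither its norm nor its form, and removes any interaction with another one; so
   the finitely supported part of the numerical range is convex, is dense in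
   [W(T)], and a point of the boundary of [W(T)] lies on a supporting line
   [s x + sigma y = lam s] with [sigma = 1] or [sigma = -1] (or a vertical one).
   By Fourier analysis along the period, [lam s] is the largest real [c] for which
   the matrix symbol [c - H_s z] is singular at some [z] of the unit circle.  Two
   elimination steps follow.  Both use that a real root which disappears when a
   parameter is moved in one direction is not simple, hence is a root of
   [gcd (D, D')]; by induction on the degree such parameters lie on an algebraic
   curve.  The first step, with the circle as variable, gives a polynomial relation
   [Q (lam s, s) = 0]; the second, with the slope [s] as variable, applies to
   [Q (s x + sigma y, s)] and gives the polynomial in [x] and [y]. *)

Set Implicit Arguments.
Unset Strict Implicit.
Unset Printing Implicit Defensive.

(** * Algebraic curves and extremal roots *)

Section Bivariate.
Context {R : realType}.
Implicit Types (g : {poly {poly R}}) (D : {poly {poly {poly R}}}).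

(** For a polynomial [D] in three variables, the parameters at which it has a real root usually fill
    an open set; only extremality confines them to a curve. A discriminant would not do: for a
    Hermitian symbol the determinant is real, so the sum of squares taken for [D] is itself a square
    and its discriminant vanishes identically. The passage to the gcd copes with this. Extremality
    also treats corners and flat parts of the boundary alike, since no differentiability of the
    support function is asked for. [W(T)] need not be closed, so a boundary point is never
    represented by a vector: what is kept of it is one supporting line and its membership in every
    closed half-plane that contains the finitely supported part. The coefficient of [y] is
    normalised to a sign so that the support function depends on the slope only. The half-bandwidth
    [m] is enlarged to the multiple [m * (n + 1)] of the period, so that shifts by it preserve
    periodic sequences. *)

Definition ev2 (p q : R) : {poly {poly R}} -> R :=
  horner_eval q \o horner_eval p%:P.

HB.instance Definition _ p q := GRing.RMorphism.on (ev2 p q).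

Lemma ev2E p q g : ev2 p q g = g.[p%:P].[q].
Proof. by []. Qed.

Lemma ev2C p q c : ev2 p q c%:P%:P = c.
Proof. by rewrite ev2E !hornerC. Qed.

Lemma continuous_ev2 g : continuous (fun z : R * R => ev2 z.1 z.2 g).
Proof.
elim/poly_ind: g => [|g c IH] z.
  by under eq_fun do rewrite raddf0; exact: cvg_cst.
under eq_fun => u do rewrite ev2E hornerMXaddC hornerD hornerM hornerC -ev2E.
apply: cvgD; first by apply: cvgM; [exact: IH|exact: cvg_fst].
apply: (@continuous_comp _ _ _ snd (horner c)); first exact: cvg_snd.
exact: continuous_horner.
Qed.

Lemma ev2_gt0_near p q g : 0 < ev2 p q g ->
  exists2 e : R, 0 < e & forall p' q',
    `|p' - p| < e -> `|q' - q| < e -> 0 < ev2 p' q' g.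
Proof.
move=> g0; have := @continuous_ev2 g (p, q) => /cvgr_dist_lt /(_ _ g0).
rewrite near_simpl => /nbhs_ballP[e/= e0 he]; exists e => // p' q' hp hq.
have /= := he (p', q') (conj _ _); rewrite /ball/= => /(_ _ _)/wrap[].
  by rewrite distrC.
  by rewrite distrC.
by rewrite ltr_distlC => /andP[+ _]; rewrite subrr.
Qed.

Lemma ev2_neq0_near p q g : ev2 p q g != 0 ->
  exists2 e : R, 0 < e & forall p' q',
    `|p' - p| < e -> `|q' - q| < e -> 0 < ev2 p' q' g * ev2 p q g.
Proof.
move=> g0; have /ev2_gt0_near[e e0 he] : 0 < ev2 p q (g * (ev2 p q g)%:P%:P).
  by rewrite rmorphM/= ev2C -expr2 exprn_even_gt0.
exists e => // p' q' hp hq; have := he _ _ hp hq.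
by rewrite rmorphM/= ev2C.
Qed.

(** The outermost variable [t] is the one in which roots are taken; [p] and [q] are parameters, and
    [p] is the one that gets moved. *)
Definition ev3 D (t p q : R) : R := (map_poly (ev2 p q) D).[t].

Lemma ev3E D t p q : ev3 D t p q = ev2 p q D.[t%:P%:P].
Proof.
by rewrite /ev3 -[X in _.[X]](ev2C p q) horner_map.
Qed.

Definition thin (S : R -> R -> Prop) : Prop :=
  exists2 g, g != 0 & forall p q, S p q -> ev2 p q g = 0.

Lemma sub_thin (S S' : R -> R -> Prop) :
  (forall p q, S p q -> S' p q) -> thin S' -> thin S.
Proof. by move=> SS' [g g0 h]; exists g => // p q /SS'/h. Qed.

Lemma thinU (S S' : R -> R -> Prop) :
  thin S -> thin S' -> thin (fun p q => S p q \/ S' p q).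
Proof.
move=> [g g0 h] [g' g'0 h']; exists (g * g'); first exact: mulf_neq0.
by move=> p q [/h|/h'] e; rewrite rmorphM/= e ?mul0r ?mulr0.
Qed.

Lemma thin_swap (S : R -> R -> Prop) : thin S -> thin (fun p q => S q p).
Proof.
move=> [g g0 h]; exists (swapXY g); first by rewrite swapXY_eq0.
by move=> p q /h; rewrite !ev2E horner2_swapXY.
Qed.

Lemma thin_ev2 g : g != 0 -> thin (fun p q => ev2 p q g = 0).
Proof. by exists g. Qed.

End Bivariate.

Section SimpleRoot.
Context {R : realType}.

(** With [p = r * (X - t)] one has [p'(t) = r(t)], so [r] keeps its sign near [t] while [X - t]
    changes sign. *)
Lemma simple_root_sign (p : {poly R}) t e : 0 < e -> p.[t] = 0 -> p^`().[t] != 0 ->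
  exists t1 t2, [/\ `|t1 - t| < e, `|t2 - t| < e, t1 < t2 & p.[t1] * p.[t2] < 0].
Proof.
move=> e0 /eqP/factor_theorem[r ->] {p}.
rewrite derivM derivXsubC mulr1 hornerD hornerM hornerXsubC subrr mulr0 add0r.
move=> rt0.
have : \forall t' \near t, 0 < r.[t'] * r.[t].
  have : 0 < r.[t] * r.[t] by rewrite -expr2 exprn_even_gt0.
  have cr : {for t, continuous (fun t' => r.[t'] * r.[t])}.
    by apply: cvgM; [exact: continuous_horner|exact: cvg_cst].
  by move=> h; exact: (cvgr_gt _ cr).
move=> /nbhs_ballP[d /= d0 hd].
pose h := Num.min d e / 2; have h0 : 0 < h by rewrite divr_gt0// lt_min d0.
have hlt : h < Num.min d e by rewrite ltr_pdivrMr// mulr_natr mulr2n ltrDl lt_min d0.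
have [hd' he'] : h < d /\ h < e by move: hlt; rewrite lt_min => /andP.
have r1 : 0 < r.[t - h] * r.[t].
  by apply: hd; rewrite /ball/= opprB addrC subrK gtr0_norm.
have r2 : 0 < r.[t + h] * r.[t].
  by apply: hd; rewrite /ball/= opprD addrA subrr sub0r normrN gtr0_norm.
exists (t - h), (t + h); split.
- by rewrite addrAC subrr sub0r normrN gtr0_norm.
- by rewrite addrAC subrr add0r gtr0_norm.
- by clear -h0; lra.
rewrite !hornerM !hornerXsubC (_ : t - h - t = - h) 1?(_ : t + h - t = h); [|ring|ring].
have : 0 < (r.[t - h] * r.[t]) * (r.[t + h] * r.[t]) by exact: mulr_gt0.
rewrite mulrACA -expr2 pmulr_lgt0 ?exprn_even_gt0// => r12.
have : 0 < r.[t - h] * r.[t + h] * h ^+ 2 by rewrite mulr_gt0// exprn_gt0.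
by rewrite expr2; lra.
Qed.

End SimpleRoot.

Section ExtremalRoot.
Context {R : realType}.
Implicit Types D : {poly {poly {poly R}}}.

Lemma deriv_neq0 (A : idomainType) (D : {poly A}) :
  [pchar A] =i pred0 -> (1 < size D)%N -> D^`() != 0.
Proof.
move=> A0 sD; apply/eqP => /(congr1 (fun p : {poly A} => p`_(size D).-2)).
rewrite coef_deriv coef0 => /eqP.
have -> : (size D).-2.+1 = (size D).-1 by case: (size D) sD => [|[]].
rewrite -mulr_natr mulf_eq0 -[D`__]/(lead_coef D) lead_coef_eq0.
rewrite ((pcharf0P _).1 A0) -size_poly_eq0.
by case: (size D) sD => [|[]].
Qed.

Lemma ev3M D D' t p q : ev3 (D * D') t p q = ev3 D t p q * ev3 D' t p q.
Proof. by rewrite /ev3 rmorphM hornerM. Qed.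

Lemma ev3D D D' t p q : ev3 (D + D') t p q = ev3 D t p q + ev3 D' t p q.
Proof. by rewrite /ev3 rmorphD hornerD. Qed.

Lemma ev3Z c D t p q : ev3 (c *: D) t p q = ev2 p q c * ev3 D t p q.
Proof. by rewrite /ev3 map_polyZ hornerZ. Qed.

(* A root that disappears as soon as [p] is moved in the direction [k] is not
   simple, by the intermediate value theorem; so it is also a root of the gcd
   of [D] and its derivative, which has smaller degree. *)
Lemma thin_extremal_root (k : R) D : D != 0 ->
  thin (fun p q => exists t e, [/\ 0 < e, ev3 D t p q = 0 & forall t' h,
    `|t' - t| < e -> 0 < h < e -> ev3 D t' (p + k * h) q != 0]).
Proof.
have [n] := ubnP (size D); elim: n D => // n IH D /ltnSE sDn D0.
have pcA : [pchar {poly {poly R}}] =i pred0.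
  by move=> i; rewrite !pchar_poly pchar_num.
have [sD|sD] := leqP (size D) 1.
  move/size1_polyC : sD D0 => ->; rewrite polyC_eq0 => D0.
  by exists D`_0 => // p q [t [e [_ + _]]]; rewrite /ev3 map_polyC hornerC.
have D'0 := deriv_neq0 pcA sD.
pose G := gcdp D D^`().
have G0 : G != 0 by rewrite gcdp_eq0 negb_and D0.
have sG : (size G < n)%N.
  apply: leq_trans sDn; apply: leq_ltn_trans (lt_size_deriv D0).
  by apply: dvdp_leq => //; exact: dvdp_gcdr.
have [[u v] /= /eqpP[[k1 k2] /andP[k10 k20]]] := Bezoutp D D^`().
rewrite -/G => bez.
have /Pdiv.Idomain.dvdpP[[k3 H] /= k30 dvd] := dvdp_gcdl D D^`().
rewrite -/G in dvd.
(* The Bezout identity and the divisibility hold only up to the factors [k2] and [k3] of the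
   coefficient ring, so the curve where one of them vanishes is set apart. *)
have bad := thin_ev2 (mulf_neq0 k20 k30).
apply: sub_thin (thinU bad (IH _ sG G0)) => p q [t [e [e0 Dt noroot]]].
have [|k23] := eqVneq (ev2 p q (k2 * k3)) 0; [by left|right].
have D't : ev3 D^`() t p q = 0.
  apply/eqP/negPn/negP; rewrite /ev3 -deriv_map => D't.
  have [t1 [t2 [t1e t2e t12 sgn]]] := simple_root_sign e0 Dt D't.
  rewrite -![_.[_]]/(ev3 _ _ _ _) !ev3E in sgn.
  have [n1 n2] : ev2 p q D.[t1%:P%:P] != 0 /\ ev2 p q D.[t2%:P%:P] != 0.
    by split; apply/negP => /eqP z; move: sgn; rewrite z ?mul0r ?mulr0 ltxx.
  have [e1 e10 he1] := ev2_neq0_near n1.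
  have [e2 e20 he2] := ev2_neq0_near n2.
  pose m := Num.min e (Num.min e1 e2).
  have m0 : 0 < m by rewrite !lt_min e0 e10 e20.
  (* Small enough that both [h] and the displacement [|k| * h] stay below [m]. *)
  pose h := m / 2 / (1 + `|k|).
  have k1gt0 : 0 < 1 + `|k| by rewrite ltr_pwDl.
  have h0 : 0 < h by rewrite !divr_gt0.
  have mm : m / 2 < m by rewrite ltr_pdivrMr// mulr_natr mulr2n ltrDl.
  have hm : h < m.
    apply: le_lt_trans mm; rewrite ler_pdivrMr// ler_peMr ?lerDl// ltW//.
    by rewrite divr_gt0.
  have khm : `|p + k * h - p| < m.
    rewrite addrAC subrr add0r normrM (gtr0_norm h0).
    apply: le_lt_trans mm; rewrite /h mulrCA ger_pMr ?divr_gt0//.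
    by rewrite ler_pdivrMr// mul1r lerDr.
  have [hme hme1 hme2] : [/\ h < e, `|p + k * h - p| < e1 & `|p + k * h - p| < e2].
    by move: hm khm; rewrite !lt_min => /and3P[-> _ _] /and3P[_ -> ->].
  have := he1 _ q hme1; rewrite subrr normr0 => /(_ e10) s1.
  have := he2 _ q hme2; rewrite subrr normr0 => /(_ e20) s2.
  have sgn' : ev2 (p + k * h) q D.[t1%:P%:P] * ev2 (p + k * h) q D.[t2%:P%:P] < 0.
    have := mulr_gt0 s1 s2; rewrite mulrACA nmulr_lgt0//.
  rewrite -!ev3E in sgn'.
  have [t' /itvP t'12 /rootP t'0] := poly_ivtoo (ltW t12) sgn'.
  have t'e : `|t' - t| < e.
    have t1t' : t1 < t' by rewrite t'12.
    have t't2 : t' < t2 by rewrite t'12.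
    move: t1e t2e t1t' t't2; rewrite !ltr_norml => /andP[+ _] /andP[_ +].
    by clear=> *; apply/andP; split; lra.
  have := noroot t' h t'e; rewrite h0 hme => /(_ isT).
  by rewrite [ev3 _ _ _ _]t'0 eqxx.
have Gt : ev3 G t p q = 0.
  have := congr1 (fun P => ev3 P t p q) bez.
  rewrite !ev3Z ev3D !ev3M Dt D't !mulr0 addr0 mulr0 => /esym/eqP.
  rewrite mulf_eq0 => /orP[/eqP z|/eqP//].
  by move: k23; rewrite rmorphM/= z mul0r eqxx.
have k3n : ev2 p q k3 != 0.
  by apply: contraNneq k23; rewrite rmorphM/= => ->; rewrite mulr0.
(* As [k3] stays nonzero near [(p, q)], a root of [G] at the moved parameter would be a root of [D]:
   the disappearance of the root passes to [G], within a smaller radius. *)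
have [e3 e30 he3] := ev2_neq0_near k3n.
have k1gt0 : 0 < 1 + `|k| by rewrite ltr_pwDl.
exists t, (Num.min e (e3 / (1 + `|k|))); split => //.
  by rewrite lt_min e0 divr_gt0.
move=> t' h; rewrite !lt_min => /andP[t'e _] /and3P[h0 he he'].
apply: contraNneq (noroot t' h t'e _) => [G't|]; last by rewrite h0.
have := congr1 (fun P => ev3 P t' (p + k * h) q) dvd.
rewrite ev3Z ev3M G't mulr0 => /eqP; rewrite mulf_eq0 => /orP[|//] /eqP z.
have kh3 : `|p + k * h - p| < e3.
  rewrite addrAC subrr add0r normrM (gtr0_norm h0).
  move: he'; rewrite ltr_pdivlMr// => he'; apply: le_lt_trans he'.
  by rewrite mulrC ler_pM2l// lerDr.
have := he3 _ q kh3; rewrite z mul0r ltxx subrr normr0 => /(_ e30).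
by [].
Qed.

End ExtremalRoot.

(** * Rings of functions *)

Section FunctionRings.
Context {R : realType} {U : Type}.
Implicit Types (P : (U -> R) -> Prop) (f g : U -> R).

(** Two instances are meant, polynomial functions of three real variables and continuous functions,
    so that determinants and Bloch forms are handled by the same closure lemmas. *)
Record function_ring P : Prop := FunctionRing {
  function_ring_cst : forall c, P (fun=> c);
  function_ringD : forall f g, P f -> P g -> P (fun u => f u + g u);
  function_ringM : forall f g, P f -> P g -> P (fun u => f u * g u) }.

Lemma function_ring_ev2 P f1 f2 (g : {poly {poly R}}) : function_ring P ->
  P f1 -> P f2 -> P (fun u => ev2 (f1 u) (f2 u) g).
Proof.
move=> PR P1 P2; elim/poly_ind: g => [|g c IH].
  by under eq_fun do rewrite raddf0; exact: function_ring_cst.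
under eq_fun => u do rewrite ev2E hornerMXaddC hornerD hornerM hornerC -ev2E.
apply: function_ringD => //; first exact: function_ringM.
elim/poly_ind: c => [|c a IHc].
  by under eq_fun do rewrite horner0; exact: function_ring_cst.
under eq_fun do rewrite hornerMXaddC.
apply: function_ringD => //; last exact: function_ring_cst.
exact: function_ringM.
Qed.

End FunctionRings.

Section PolynomialFunctions.
Context {R : realType}.

(** An existence statement, so that the polynomial behind a determinant or a substitution never has
    to be written down. *)
Definition polyfun3 (f : R * R * R -> R) : Prop :=
  exists D, forall u, ev3 D u.1.1 u.1.2 u.2 = f u.

Lemma polyfun3_ring : function_ring polyfun3.
Proof.
split=> [c|f g [D hD] [D' hD']|f g [D hD] [D' hD']].
- by exists c%:P%:P%:P => u; rewrite ev3E hornerC ev2C.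
- by exists (D + D') => u; rewrite ev3D hD hD'.
- by exists (D * D') => u; rewrite ev3M hD hD'.
Qed.

Lemma polyfun3_1 : polyfun3 (fun u => u.1.1).
Proof. by exists 'X => u; rewrite ev3E hornerX ev2C. Qed.

Lemma polyfun3_2 : polyfun3 (fun u => u.1.2).
Proof. by exists 'X%:P => u; rewrite ev3E hornerC ev2E hornerX hornerC. Qed.

Lemma polyfun3_3 : polyfun3 (fun u => u.2).
Proof. by exists 'X%:P%:P => u; rewrite ev3E hornerC ev2E hornerC hornerX. Qed.

Lemma poly_neq0_horner (A : idomainType) (p : {poly A}) (s : nat -> A) :
  injective s -> p != 0 -> exists n, p.[s n] != 0.
Proof.
move=> sI p0; apply: contrapT => h.
have : all (root p) (map s (iota 0 (size p))).
  by apply/allP => _ /mapP[i _ ->]; apply/rootP/eqP/negPn/negP => z; apply: h; exists i.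
move=> /(max_poly_roots p0); rewrite map_inj_uniq// iota_uniq => /(_ isT).
by rewrite size_map size_iota ltnn.
Qed.

Lemma ev2_neq0 (g : {poly {poly R}}) : g != 0 -> exists p q, ev2 p q g != 0.
Proof.
move=> g0.
have nI : injective (fun n : nat => n%:R : R).
  by move=> i j /eqP; rewrite eqr_nat => /eqP.
have [|n gn] := poly_neq0_horner (s := fun n => (n%:R : R)%:P) _ g0.
  by move=> i j /polyC_inj/nI.
have [m gnm] := poly_neq0_horner nI gn.
by exists n%:R, m%:R.
Qed.

Lemma ev2_map p q (g : {poly {poly R}}) :
  ev2 p q g = (map_poly (horner_eval q) g).[p].
Proof.
by rewrite ev2E -[p in RHS](hornerC p q) -[p%:P.[q]]/(horner_eval q p%:P) horner_map.
Qed.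

End PolynomialFunctions.

(** * From the support function to boundary points *)

Section Tangents.
Context {R : realType}.
Implicit Types (P Q : {poly {poly R}}) (phi : R -> R).

Let null phi P := exists2 q : {poly R}, q != 0 &
  forall s, q.[s] != 0 -> ev2 (phi s) s P = 0.

(** A factor [g] occurring twice in [Q] may be kept once: the product still vanishes on the graph of
    [phi], and the degree drops. *)
Lemma separable_null phi Q : Q != 0 -> null phi Q ->
  exists2 P, P != 0 /\ separable_poly P & null phi P.
Proof.
have [n] := ubnP (size Q); elim: n Q => // n IH Q /ltnSE sQ Q0 nQ.
have [sep|nsep] := boolP (separable_poly Q); first by exists Q.
have pcA : [pchar {poly R}] =i pred0 by move=> i; rewrite pchar_poly pchar_num.
have [u [v [uvQ cuv]]] : exists u v, u * v %| Q /\ ~~ coprimep u v.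
  apply: contrapT => h; move/negP: nsep; apply; apply/separable_polyP; split.
    by move=> u v uvQ; apply/negPn/negP => cuv; apply: h; exists u, v.
  by move=> u _; exact: deriv_neq0.
pose g := gcdp u v.
have /Pdiv.Idomain.dvdpP[[c H] /= c0 dvd] : g * g %| Q.
  by apply: dvdp_trans uvQ; rewrite dvdp_mul ?dvdp_gcdl ?dvdp_gcdr.
have : c *: Q != 0 by rewrite -mul_polyC mulf_neq0 ?polyC_eq0.
rewrite dvd !mulf_eq0 !negb_or => /and3P[H0 g0 _].
apply: (IH (H * g)); last 2 first.
- by rewrite mulf_neq0.
- case: nQ => q q0 hq; exists q => // s /hq Qs.
  have := congr1 (ev2 (phi s) s) dvd.
  rewrite -mul_polyC !rmorphM/= Qs mulr0 => /esym/eqP z.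
  by apply/eqP; move: z; rewrite !mulf_eq0 => /orP[->//|/orP[]->]; rewrite ?orbT.
apply: leq_trans sQ; rewrite -(size_scale Q c0) dvd mulrA.
rewrite [X in (_ < X)%N]size_mul ?mulf_neq0//.
move: cuv; rewrite /coprimep -/g; rewrite -size_poly_gt0 in g0.
have : (0 < size (H * g)%R)%N by rewrite size_poly_gt0 mulf_neq0// -size_poly_gt0.
case: (size g) g0 => [|[|k]]// _; case: (size (H * g)%R) => // l _ _.
by rewrite !addnS/= ltnS leq_addr.
Qed.

Lemma thin_lines (sigma : R) phi (l : seq R) : sigma ^+ 2 = 1 ->
  thin (fun y x => exists2 s, s \in l & phi s = s * x + sigma * y).
Proof.
move=> s1; elim: l => [|s l IH]; first by exists 1; rewrite ?oner_eq0// => ? ? [].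
pose g : {poly {poly R}} := sigma%:P *: 'X + (s *: 'X - (phi s)%:P)%:P.
have gE y x : ev2 y x g = sigma * y + s * x - phi s.
  by rewrite ev2E !hornerE/=; ring.
have g0 : g != 0.
  apply/eqP => z; have := gE (sigma * (phi s + 1)) 0.
  rewrite z raddf0 mulrA -expr2 s1 => /eqP; apply/negP; rewrite eq_sym.
  by rewrite mul1r mulr0 addr0 addrAC subrr add0r oner_eq0.
apply: sub_thin (thinU (thin_ev2 g0) IH) => y x [s']; rewrite inE.
case/predU1P => [->|s'l] e; last by right; exists s'.
by left; rewrite gE e; ring.
Qed.

(* [phi] is a support function; away from the finitely many [s] where the branch
   through [(s, phi s)] of the separable curve [P = 0] is not simple, that curve
   is locally the graph of [phi], so that moving the line away from the convex
   set makes the root [s] disappear. *)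
Lemma thin_tangent (sigma B : R) phi Q : sigma ^+ 2 = 1 ->
  (forall s s', `|phi s - phi s'| <= B * `|s - s'|) ->
  Q != 0 -> (forall s, ev2 (phi s) s Q = 0) ->
  thin (fun x y => (exists s, phi s = s * x + sigma * y) /\
                   forall s, s * x + sigma * y <= phi s).
Proof.
(* The swap makes [y] the parameter that is moved. *)
move=> sg phiB Q0 Qphi; apply: (@thin_swap _ (fun y x => _)).
have [|P [P0 sepP] [q q0 hq]] := separable_null (phi := phi) Q0.
  by exists 1; rewrite ?oner_eq0.
have /Bezout_coprimepP[[u v]] : coprimep P P^`() by move: sepP; rewrite unlock.
move=> /eqpP[[k1 k2] /andP[k10 k20]] /= bez.
(* The Bezout identity for [P] and [P'] leaves a nonzero polynomial [k2] in [s] alone: off its roots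
   and those of [q], the derivative does not vanish on the graph of [phi]. *)
have dP s : (q * k2).[s] != 0 -> ev2 (phi s) s P^`() != 0.
  rewrite hornerM mulf_eq0 negb_or => /andP[qs k2s].
  apply: contraNneq k2s => z; have := congr1 (ev2 (phi s) s) bez.
  rewrite -!mul_polyC !(rmorphM, rmorphD)/= (hq _ qs) z !mulr0 addr0 mulr0.
  by rewrite rmorph1 mulr1 ev2E hornerC => <-.
have [D hD] : polyfun3 (fun u : R * R * R => ev2 (u.1.1 * u.2 + sigma * u.1.2) u.1.1 P).
  apply: function_ring_ev2 => //; [exact: polyfun3_ring| |exact: polyfun3_1].
  have FR := @polyfun3_ring R.
  apply: (function_ringD FR); apply: (function_ringM FR) => //.
  - exact: polyfun3_1.
  - exact: polyfun3_3.
  - exact: (function_ring_cst FR).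
  - exact: polyfun3_2.
have {}hD t y x : ev3 D t y x = ev2 (t * x + sigma * y) t P := hD (t, y, x).
have D0 : D != 0.
  have [c [t]] := ev2_neq0 P0; apply: contraNneq => z.
  have := hD t (sigma * c) 0; rewrite z mulrA -expr2 sg mulr0 add0r mul1r => <-.
  by rewrite ev3E horner0 raddf0.
(* The finitely many bad slopes contribute finitely many lines. The direction [- sigma] lowers
   [s * x + sigma * y] by exactly [h], because [sigma ^+ 2 = 1]. *)
apply: sub_thin (thinU (thin_lines phi (rootsR (q * k2)) sg)
  (thin_extremal_root (- sigma) D0)) => y x [[s phis] phige].
have [z|ks] := eqVneq (q * k2).[s] 0; [left|right].
  by exists s => //; rewrite -(roots_on_rootsR (mulf_neq0 q0 k20)) in_itv/=; apply/rootP.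
have [e1 e10 he1] := ev2_neq0_near (dP _ ks).
have [e2 e20 he2] : exists2 e, 0 < e &
    forall s', `|s' - s| < e -> (q * k2).[s'] != 0.
  have : ev2 0 s (q * k2)%:P != 0 by rewrite ev2E hornerC.
  move=> /ev2_neq0_near[e e0 he]; exists e => // s' s's.
  have := he 0 s'; rewrite subrr normr0 => /(_ e0 s's).
  by rewrite ev2E hornerC; apply: contraTneq => ->; rewrite mul0r ltxx.
(* Once [h] and [|s' - s|] are below [e1 / K], the Lipschitz bound keeps everything between the
   lowered value [c] and [phi s'] within [e1] of [phi s]. *)
pose K := 1 + `|x| + `|B|; have K1 : 1 <= K by rewrite /K -addrA lerDl addr_ge0.
have K0 : 0 < K by exact: lt_le_trans K1.
have e1K : 0 < e1 / K by exact: divr_gt0.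
exists s, (Num.min e2 (e1 / K)); split.
- by rewrite lt_min e20.
- rewrite hD -phis; apply: hq.
  by move: ks; rewrite hornerM mulf_eq0 negb_or => /andP[].
move=> s' h; rewrite !lt_min => /andP[s'e2 s'e1] /and3P[h0 _ he].
rewrite hD; set c := _ + _.
have cE : c = s' * x + sigma * y - h.
  by rewrite /c mulrDr mulrA mulrN -expr2 sg; ring.
have cphi : c < phi s' by have := phige s'; rewrite cE; clear -h0; lra.
apply/eqP => Pc.
have Pphi : ev2 (phi s') s' P = 0.
  apply: hq; have := he2 _ s'e2.
  by rewrite hornerM mulf_eq0 negb_or => /andP[].
(* By Rolle, the two roots [c < phi s'] at slope [s'] force a root of the derivative near
   [(phi s, s)], where the derivative has constant sign. *)
have [d dc] : exists2 d, c < d < phi s' & ev2 d s' P^`() = 0.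
  rewrite !ev2_map in Pc Pphi.
  have [d dcp d0] := poly_rolle cphi (etrans Pc (esym Pphi)).
  by exists d => //; rewrite ev2_map -deriv_map.
move=> /eqP; apply/negP; suff : 0 < ev2 d s' P^`() * ev2 (phi s) s P^`().
  by apply: contraTneq => ->; rewrite mul0r ltxx.
have eK : e1 = e1 / K * (1 + `|x| + `|B|) by rewrite -/K divfK// gt_eqF.
have ds1 : `|s' - s| * `|x| <= e1 / K * `|x| by rewrite ler_wpM2r// ltW.
have ds2 : `|B| * `|s' - s| <= e1 / K * `|B| by rewrite mulrC ler_wpM2r// ltW.
have x0 : 0 <= e1 / K * `|x| by rewrite mulr_ge0// ltW.
have B0 : 0 <= e1 / K * `|B| by rewrite mulr_ge0// ltW.
have e1E : e1 = e1 / K + e1 / K * `|x| + e1 / K * `|B|.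
  by rewrite {1}eK; ring.
apply: he1; last by apply: lt_le_trans s'e1 _; rewrite ler_pdivrMr// ler_peMr// ltW.
have phis' : phi s' - phi s <= `|B| * `|s' - s|.
  apply: le_trans (ler_norm _) _; apply: le_trans (phiB _ _) _.
  by rewrite ler_wpM2r// ler_norm.
have sx : - (`|s' - s| * `|x|) <= s' * x - s * x.
  by rewrite -mulrBl -normrM lerNl -normrN ler_norm.
case/andP: dc => cd dphi; rewrite ltr_norml.
by apply/andP; split; move: cE phis;
  clear -h0 he e1E ds1 ds2 x0 B0 e1K phis' sx cd dphi; move: c cd => c *; lra.
Qed.

End Tangents.

(** * Periodic banded forms and their symbols *)

Section RootsOfUnity.
Variable C : numClosedFieldType.
Implicit Types z : C.

Lemma unit_circle_unity n z : (0 < n)%N -> z ^+ n = 1 -> z * z^* = 1.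
Proof.
move=> n0 zn; rewrite -normCK; have /eqP : `|z| ^+ n = 1 by rewrite -normrX zn normr1.
by rewrite pexpr_eq1// => /eqP->; rewrite expr1n.
Qed.

Lemma unit_circleX n z : z * z^* = 1 -> z ^+ n * (z^*) ^+ n = 1.
Proof. by move=> zz; rewrite -exprMn zz expr1n. Qed.

Lemma exists_primitive_root n : (0 < n)%N -> exists z, n.-primitive_root z.
Proof.
move=> n0; have [rs /= rsE] := closed_field_poly_normal ('X^n - 1 : {poly C}).
rewrite (monicP (monicXnsubC 1 n0)) scale1r in rsE.
have sz : size rs = n.
  have := congr1 (fun p : {poly C} => size p) rsE.
  by rewrite size_XnsubC// size_prod_XsubC => -[].
have urs : all n.-unity_root rs.
  apply/allP => z zrs; rewrite unity_rootE -subr_eq0.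
  have : root ('X^n - 1%:P) z by rewrite rsE root_prod_XsubC.
  by rewrite /root !hornerE.
have : has n.-primitive_root rs.
  apply: has_prim_root => //; last by rewrite sz.
  rewrite -separable_prod_XsubC -rsE; apply: separable_Xn_sub_1.
  by rewrite pnatr_eq0 -lt0n.
by move=> /hasP[z _ pz]; exists z.
Qed.

Lemma unity_orthogonality n z p q : n.-primitive_root z -> (p < n)%N -> (q < n)%N ->
  \sum_(l < n) (z ^+ l) ^+ p * ((z ^+ l)^*) ^+ q = (p == q)%:R * n%:R.
Proof.
move=> pz pn qn; have n0 := prim_order_gt0 pz.
have zz := unit_circle_unity n0 (prim_expr_order pz).
pose y := z ^+ p * (z^*) ^+ q.
under eq_bigr => l _ do
  rewrite rmorphXn -!exprM mulnC (mulnC l) !exprM -exprMn -/y.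
have [pq|pq] := eqVneq p q.
  by rewrite /y pq unit_circleX//; under eq_bigr do rewrite expr1n;
    rewrite sumr_const card_ord mul1r.
rewrite mul0r; have y1 : y != 1.
  apply: contraNneq pq => y1; suff : z ^+ p == z ^+ q.
    by rewrite (eq_prim_root_expr pz) !modn_small.
  by rewrite -[z ^+ q]mul1r -y1 /y -mulrA -exprMn [z^* * _]mulrC zz expr1n mulr1.
have yn : y ^+ n = 1.
  rewrite /y exprMn -!exprM mulnC (mulnC q) !exprM -rmorphXn.
  by rewrite (prim_expr_order pz) rmorph1 !expr1n mulr1.
have := subrX1 y n; rewrite yn subrr => /esym/eqP.
by rewrite mulf_eq0 subr_eq0 (negbTE y1) => /eqP.
Qed.

End RootsOfUnity.

Lemma mulr_sum_sum (A : comNzRingType) (n : nat) (a : A) (F G : 'I_n -> A) :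
  a * (\sum_i F i) * (\sum_j G j) = \sum_i \sum_j a * F i * G j.
Proof.
rewrite -mulrA big_distrlr mulr_sumr; apply: eq_bigr => i _.
by rewrite mulr_sumr; apply: eq_bigr => j _; rewrite mulrA.
Qed.

Lemma sum_widen (V : nmodType) (B A : nat) (F : nat -> V) : (B <= A)%N ->
  (forall k, (B <= k < A)%N -> F k = 0) -> \sum_(k < A) F k = \sum_(k < B) F k.
Proof.
move=> BA F0; rewrite -(subnKC BA) big_split_ord/= [X in _ + X]big1 ?addr0//.
by move=> k _; rewrite F0// leq_addr -ltn_subRL ltn_ord.
Qed.

Lemma sum_drop (V : nmodType) (p B : nat) (F : nat -> V) :
  (forall k, (k < p)%N -> F k = 0) ->
  \sum_(k < p + B) F k = \sum_(k < B) F (p + k)%N.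
Proof.
by move=> F0; rewrite big_split_ord/= big1 ?add0r// => k _; rewrite F0.
Qed.

Section PeriodicForms.
Variable C : numClosedFieldType.
Implicit Types (b : int -> int -> C) (x y w : nat -> C) (z : C).

Definition periodic_diags (d : nat) b := forall r j, b r (j + d%:Z) = b r j.

Definition banded (M : nat) b := forall r j, M%:Z < `|r| -> b r j = 0.

Definition band_form b (L : nat) x y : C :=
  \sum_(j < L) \sum_(k < L) b (k%:Z - j%:Z) j%:Z * x k * (y j)^*.

(* The symbol acts on [d]-periodic sequences [w] as the operator on the formal
   Bloch waves [z ^ k * w k]; all the powers of [z] are made nonnegative by
   [z^-1 = z^*], which holds on the unit circle, and the index [j + r] stands for
   [j + r - M], as [M] is always a multiple of [d]. *)
Definition bloch_row b (M : nat) z w (j : nat) : C :=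
  \sum_(r < M.*2.+1)
     b (r%:Z - M%:Z) j%:Z * (z ^+ r * (z^*) ^+ M) * w (j + r)%N * (w j)^*.

Definition bloch b (d M : nat) z w : C := \sum_(j < d) bloch_row b M z w j.

Lemma periodicM d b k : periodic_diags d b ->
  forall r j, b r (j + (k * d)%:Z) = b r j.
Proof.
move=> pb r j; elim: k => [|k IH]; first by rewrite mul0n addr0.
by rewrite mulSn addnC PoszD addrA pb.
Qed.

Lemma periodic_mod d b r (j : nat) : periodic_diags d b ->
  b r (j %% d)%N%:Z = b r j%:Z.
Proof.
by move=> pb; rewrite {2}(divn_eq j d) addnC PoszD periodicM.
Qed.

Lemma periodic_seqM d w k : (forall i, w (i + d)%N = w i) ->
  forall i, w (i + k * d)%N = w i.
Proof.
move=> pw i; elim: k => [|k IH]; first by rewrite mul0n addn0.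
by rewrite mulSn addnCA addnC pw.
Qed.

(** Puts an entry of the matrix in the shape produced by the orthogonality of roots of unity; at
    most one [r] contributes. *)
Lemma sum_band b M (j k : nat) : banded M b ->
  \sum_(r < M.*2.+1) (r + j == M + k)%N%:R * b (r%:Z - M%:Z) j%:Z =
  b (k%:Z - j%:Z) j%:Z.
Proof.
move=> bb; have [le|gt] := lerP `|k%:Z - j%:Z| M%:Z; last first.
  rewrite bb// big1// => r _; case: eqP => [e|]; last by rewrite mul0r.
  by rewrite bb ?mulr0//; lia.
have rP : (M + k - j < M.*2.+1)%N by lia.
rewrite (bigD1 (Ordinal rP))//= big1 => [|r].
  have -> : (M + k - j + j)%N = (M + k)%N by lia.
  have -> : (M + k - j)%N%:Z - M%:Z = k%:Z - j%:Z by lia.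
  by rewrite eqxx mul1r addr0.
rewrite -val_eqE/= => rne; case: eqP => [e|]; last by rewrite mul0r.
by exfalso; move/eqP : rne; apply; lia.
Qed.

Lemma band_form_ge0 b d M : (0 < d)%N -> (d %| M)%N -> periodic_diags d b -> banded M b ->
  (forall z w, z * z^* = 1 -> (forall i, w (i + d)%N = w i) ->
     0 <= bloch b d M z w) ->
  forall L x, 0 <= band_form b L x x.
Proof.
(* [n] exceeds all the exponents [r + j] and [M + k], so orthogonality selects their equality and
   not merely their congruence modulo [n]. *)
move=> d0 dM pb bb hb L x; pose n := (M.*2 + L).+1.
have [z pz] := exists_primitive_root C (ltn0Sn (M.*2 + L)).
pose e (i k : nat) : C := (i == k %[mod d])%:R.
(* [band_form b L x x] is the average of the form of the symbol over the [n]-th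
   roots of unity [z ^+ l], evaluated at the partial Fourier transforms [w l]. *)
pose w (l i : nat) := \sum_(k < L) e k i * x k * ((z ^+ l)^*) ^+ k.
have wP l i : w l (i + d)%N = w l i.
  by rewrite /w /e; under eq_bigr do rewrite modnDr.
have zl (l : nat) : z ^+ l * (z ^+ l)^* = 1.
  by rewrite rmorphXn unit_circleX// (unit_circle_unity _ (prim_expr_order pz)).
rewrite -(@pmulr_rge0 _ n%:R) ?ltr0n//.
rewrite (_ : _ * _ = \sum_(l < n) bloch b d M (z ^+ l) (w l)); last first.
  (* Here [i] is the residue of [j]; when [r + j = M + k], the divisibility of [M] by [d] makes [k]
     congruent to [i + r], so the residue indicators are automatic. *)
  transitivity (\sum_(i < d) \sum_(j < L) \sum_(k < L) \sum_(r < M.*2.+1)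
      e k (i + r)%N * e j i * b (r%:Z - M%:Z) i%:Z * x k * (x j)^* *
      ((r + j == M + k)%N%:R * n%:R)).
    rewrite mulr_sumr exchange_big/=; apply: eq_bigr => j _.
    have jd : (j %% d < d)%N by rewrite ltn_mod.
    rewrite (bigD1 (Ordinal jd))//= [X in _ = _ + X]big1 ?addr0; last first.
      move=> i /negP ine; rewrite big1// => k _; rewrite big1// => r _.
      rewrite /e [j == i %[mod d]]negbTE ?mulr0 ?mul0r//; apply/negP => /eqP ji.
      by apply: ine; rewrite -val_eqE/= ji modn_small.
    rewrite mulr_sumr; apply: eq_bigr => k _.
    rewrite -(@sum_band b M j k)// !mulr_suml mulr_sumr.
    apply: eq_bigr => r _; rewrite periodic_mod//.
    rewrite /e modn_mod eqxx; case: (r + j =P M + k)%N => [rj|_]; last first.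
      by rewrite !(mul0r, mulr0).
    rewrite (_ : k == _ %[mod d]); first by rewrite /=; ring.
    rewrite modnDml addnC rj -modnDml; move: dM => /eqP->.
    by rewrite add0n.
  rewrite /bloch [RHS]exchange_big/=; apply: eq_bigr => i _.
  rewrite /bloch_row [RHS]exchange_big/= [LHS]exchange_big/=.
  under eq_bigr do rewrite exchange_big/=.
  rewrite exchange_big/=; apply: eq_bigr => r _.
  under [RHS]eq_bigr => l _.
    rewrite /w rmorph_sum/= mulr_sum_sum.
    over.
  rewrite [RHS]exchange_big/=; apply: eq_bigr => k _.
  rewrite [RHS]exchange_big/=; apply: eq_bigr => j _.
  rewrite -(unity_orthogonality pz); last 2 first.
  - by rewrite /n; have := ltn_ord r; have := ltn_ord j; lia.
  - by rewrite /n; have := ltn_ord k; lia.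
  rewrite mulr_sumr; apply: eq_bigr => l _.
  by rewrite !(rmorphM, rmorphXn)/= conjCK /e rmorph_nat !exprD; ring.
by apply: sumr_ge0 => l _; apply: hb.
Qed.

Lemma sum_periodic (d k : nat) (F : nat -> C) : (forall j, F (j + d)%N = F j) ->
  \sum_(j < k * d) F j = k%:R * \sum_(j < d) F j.
Proof.
move=> pF; elim: k => [|k IH]; first by rewrite mul0n big_ord0 mul0r.
rewrite mulSn addnC big_split_ord/= IH -[X in _ = X * _]natr1 mulrDl mul1r.
by congr (_ + _); apply: eq_bigr => j _; rewrite addnC periodic_seqM.
Qed.

(* On a truncated Bloch wave all rows of the form are complete rows of the symbol,
   except for two end blocks that do not depend on the length. *)
Lemma band_form_bloch_wave b d m z w P : periodic_diags d b -> banded (m * d) b ->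
  z * z^* = 1 -> (forall i, w (i + d)%N = w i) ->
  let x k := z ^+ k * w k in
  band_form b (m * d + (P * d + m * d)) x x =
  band_form b (m * d + m * d) x x + P%:R * bloch b d (m * d) z w.
Proof.
move=> pb bb zz pw x; set M := (m * d)%N.
pose g (j k : nat) : C := b (k%:Z - j%:Z) j%:Z * x k * (x j)^*.
have g0 (j k : nat) : (k + M < j)%N || (j + M < k)%N -> g j k = 0.
  by move=> jk; rewrite /g bb ?mul0r//; lia.
have xP k : x (P * d + k)%N = z ^+ (P * d) * x k.
  by rewrite /x addnC (periodic_seqM _ pw) exprD; ring.
have zP : z ^+ (P * d) * (z^*) ^+ (P * d) = 1 by exact: unit_circleX.
have gP (j k : nat) : g (P * d + j)%N (P * d + k)%N = g j k.
  rewrite /g (_ : _ - _ = k%:Z - j%:Z); last by lia.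
  rewrite (_ : (P * d + j)%N%:Z = j%:Z + (P * d)%N%:Z); last by lia.
  rewrite periodicM// !xP rmorphM rmorphXn/=.
  by rewrite -[RHS]mul1r -zP; ring.
rewrite -[LHS]/(\sum_(j < _) \sum_(k < _) g j k).
rewrite -[band_form _ _ _ _]/(\sum_(j < _) \sum_(k < _) g j k).
(* Rows are cut into the first [M], the middle [P * d] and the last [M]. The first see only columns
   below [2 M], the last are translates by [P * d] of the last rows of the short form, and the
   middle ones are complete. *)
rewrite big_split_ord/= [X in _ + X]big_split_ord/= [in RHS]big_split_ord/=.
rewrite [RHS]addrAC -[RHS]addrA; congr (_ + _).
  apply: eq_bigr => j _; apply: sum_widen; first lia.
  by move=> k; have := ltn_ord j; move=> ? ?; apply: g0; lia.
congr (_ + _); last first.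
  apply: eq_bigr => j _.
  rewrite (_ : (M + (P * d + M) = P * d + (M + M))%N); last by lia.
  rewrite (@sum_drop _ _ _ (g (M + (P * d + j))%N)).
    by apply: eq_bigr => k _; rewrite addnCA gP.
  by move=> k kP; apply: g0; lia.
rewrite /bloch -sum_periodic; last first.
  move=> j; rewrite /bloch_row; apply: eq_bigr => r _.
  by rewrite PoszD pb addnAC !pw.
apply: eq_bigr => j _; have jP := ltn_ord j.
rewrite (_ : (M + (P * d + M) = j + (M + M + (P * d - j)))%N); last by lia.
rewrite (@sum_drop _ _ _ (g (M + j)%N)); last by move=> k kj; apply: g0; lia.
rewrite (@sum_widen _ M.*2.+1 _ (fun k => g (M + j)%N (j + k)%N)); [|lia|]; last first.
  by move=> k kM; apply: g0; lia.
apply: eq_bigr => r _.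
rewrite /g (_ : (j + r)%N%:Z - (M + j)%N%:Z = r%:Z - M%:Z); last by lia.
rewrite (_ : (M + j)%N%:Z = j%:Z + M%:Z); last by lia.
rewrite periodicM// /x (addnC M j) (periodic_seqM _ pw).
rewrite (rmorphM (@Num.conj C)) (rmorphXn (@Num.conj C))/= !exprD.
rewrite -[in RHS](mulr1 (b _ _)) -(unit_circleX j zz).
by ring.
Qed.

Definition shifted c b (r j : int) : C := c * (r == 0)%:R - b r j.

Lemma periodic_shifted d c b : periodic_diags d b -> periodic_diags d (shifted c b).
Proof. by move=> pb r j; rewrite /shifted pb. Qed.

Lemma banded_shifted M c b : banded M b -> banded M (shifted c b).
Proof.
move=> bb r j rM; rewrite /shifted bb// subr0.
by case: eqP rM => [->|_ _]; rewrite ?normr0 ?mulr0//; lia.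
Qed.

Definition sqnorm L x : C := \sum_(j < L) x j * (x j)^*.

Lemma band_form_shifted c b L x :
  band_form (shifted c b) L x x = c * sqnorm L x - band_form b L x x.
Proof.
rewrite /band_form /sqnorm mulr_sumr -sumrB; apply: eq_bigr => j _.
rewrite -[c * _](_ : \sum_(k < L) c * (k%:Z - j%:Z == 0)%:R * x k * (x j)^* = _).
  by rewrite -sumrB; apply: eq_bigr => k _; rewrite /shifted; ring.
rewrite (bigD1 j)//= subrr eqxx big1 ?addr0 => [|k kj]; first by rewrite mulr1 mulrA.
rewrite subr_eq0 eqz_nat; move: kj; rewrite -val_eqE/= => /negbTE->.
by rewrite mulr0 !mul0r.
Qed.

Lemma bloch_shifted c b d m z w : z * z^* = 1 -> (forall i, w (i + d)%N = w i) ->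
  bloch (shifted c b) d (m * d) z w =
  c * sqnorm d w - bloch b d (m * d) z w.
Proof.
move=> zz pw; rewrite /bloch /sqnorm mulr_sumr -sumrB; apply: eq_bigr => j _.
set M := (m * d)%N.
rewrite -[c * _](_ : \sum_(r < M.*2.+1) c * (r%:Z - M%:Z == 0)%:R *
    (z ^+ r * (z^*) ^+ M) * w (j + r)%N * (w j)^* = _).
  by rewrite /bloch_row -sumrB; apply: eq_bigr => r _; rewrite /shifted; ring.
have MP : (M < M.*2.+1)%N by lia.
rewrite (bigD1 (Ordinal MP))//= subrr eqxx big1 ?addr0 => [|r].
  by rewrite unit_circleX// !mulr1 (periodic_seqM _ pw) mulrA.
rewrite -val_eqE/= => /negbTE rM.
by rewrite subr_eq0 eqz_nat rM mulr0 !mul0r.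
Qed.

End PeriodicForms.

(** * The matrix symbol and its kernel *)

Section SymbolMatrix.
Variable C : numClosedFieldType.
Variables (n m : nat).
Implicit Types (b : int -> int -> C) (z : C).
Local Notation d := n.+1.
Local Notation M := (m * d)%N.

Definition periodic_ext (v : 'cV[C]_d) (k : nat) : C := v (inZp k) ord0.

Lemma periodic_extP v k : periodic_ext v (k + d) = periodic_ext v k.
Proof. by congr (v _ _); apply: val_inj => /=; rewrite modnDr. Qed.

Lemma sqnorm_periodic_ext v : sqnorm d (periodic_ext v) = \sum_i `|v i ord0| ^+ 2.
Proof.
apply: eq_bigr => i _; rewrite /periodic_ext normCK.
by have -> : inZp i = i by apply: val_inj; rewrite /= modn_small.
Qed.

(* [p r] stands for the factor [z ^ (r - M)] of the diagonal [r - M]. *)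
Definition symbol b (p : nat -> C) : 'M[C]_d :=
  \matrix_(i, k) \sum_(r < M.*2.+1)
     (k == inZp (i + r))%:R * (b (r%:Z - M%:Z) i%:Z * p r).

Definition circle_symbol b z := symbol b (fun r => z ^+ r * (z^*) ^+ M).

Lemma bloch_symbol b z v : bloch b d M z (periodic_ext v) =
  \sum_i (circle_symbol b z *m v) i ord0 * (v i ord0)^*.
Proof.
apply: eq_bigr => i _; rewrite mxE mulr_suml.
under [RHS]eq_bigr do rewrite mxE !mulr_suml.
rewrite exchange_big/=; apply: eq_bigr => r _.
rewrite (bigD1 (inZp (i + r)))//= eqxx [X in _ = _ + X]big1 => [|k /negbTE->].
  rewrite addr0 /periodic_ext mul1r.
  by have -> : inZp i = i by apply: val_inj; rewrite /= modn_small.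
by rewrite !mul0r.
Qed.

(* Minimality of [h] at [v] in the directions [t A v] and [t 'i A v]. *)
Lemma psd_kernel (A : 'M[C]_d) (v : 'cV[C]_d) :
  let h (u : 'cV[C]_d) := \sum_i (A *m u) i ord0 * (u i ord0)^* in
  (forall u, 0 <= h u) -> h v = 0 -> A *m v = 0.
Proof.
move=> h h0 hv; set u := A *m v.
pose p := \sum_i u i ord0 * (u i ord0)^*.
pose q := \sum_i (A *m u) i ord0 * (v i ord0)^*.
have hE t : h (v + t *: u) = t^* * p + t * q + t * t^* * h u.
  rewrite -[RHS]add0r -hv /h /p /q !mulr_sumr -!big_split/=.
  apply: eq_bigr => i _; rewrite mulmxDr -scalemxAr !mxE -/u rmorphD rmorphM/=.
  ring.
have p0 : 0 <= p by apply: sumr_ge0 => i _; rewrite mul_conjC_ge0.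
have K0 : 0 <= h u by [].
have pR : p \is Num.real by exact: ger0_real.
have qR : q \is Num.real.
  have -> : q = h (v + 1 *: u) - p - h u by rewrite hE conjC1; ring.
  by rewrite !rpredB// ger0_real.
have pq : p = q.
  have iR : 'i * (q - p) \is Num.real.
    have -> : 'i * (q - p) = h (v + 'i *: u) - h u.
      by rewrite hE -normCK normCi conjCi; ring.
    by rewrite rpredB// ger0_real.
  have qpR : q - p \is Num.real by rewrite rpredB.
  have /Creal_ImP := iR; rewrite ImMil (Creal_ReP _ qpR) => /eqP.
  by rewrite subr_eq0 => /eqP.
suff p_eq0 : p = 0.
  have uu i : i \in index_enum 'I_d -> true -> 0 <= u i ord0 * (u i ord0)^*.
    by rewrite mul_conjC_ge0.
  apply/matrixP => i j; rewrite ord1 [RHS]mxE; apply/eqP.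
  rewrite -mul_conjC_eq0; apply/eqP.
  by apply: (psumr_eq0P (F := fun i => u i ord0 * (u i ord0)^*)) p_eq0 i isT => k _;
    rewrite mul_conjC_ge0.
have K1 : 0 < h u + 1 by rewrite ltr_wpDl.
(* The minimiser would be [- p / h u]; the added [1] keeps the denominator nonzero and still yields
   a negative value unless [p = 0]. *)
pose s := - (p / (h u + 1)).
have sR : s^* = s by apply: CrealP; rewrite rpredN rpred_div// ger0_real// ltW.
have := h0 (v + s *: u); rewrite hE sR -pq.
rewrite (_ : _ + _ = - (p ^+ 2 * ((h u + 2) / (h u + 1) ^+ 2))); last first.
  by rewrite /s; field; rewrite gt_eqF.
rewrite oppr_ge0 pmulr_lle0; last by rewrite divr_gt0 ?exprn_gt0// ltr_wpDl.
move=> p2; have : p ^+ 2 == 0 by rewrite eq_le p2 exprn_ge0.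
by rewrite expf_eq0/= => /eqP.
Qed.

End SymbolMatrix.


Section CircleMaximum.
Context {R : realType}.
Local Notation C := R[i].
Variables (n m : nat).
Implicit Types (b : int -> int -> C) (z : C).
Local Notation d := n.+1.
Local Notation M := (m * d)%N.

Lemma nonneg_slope (e h : C) : (forall P : nat, 0 <= e + P%:R * h) -> 0 <= h.
Proof.
move=> eh; have := eh 0%N; have := eh 1%N; rewrite mul0r addr0 mul1r !lecE/=.
case: e h eh => [e1 e2] [h1 h2] eh /=.
move=> /andP[/eqP e12 _] /andP[/eqP e2_0 e1_ge0].
apply/andP; split; first by apply/eqP; move: e12; rewrite e2_0 add0r.
rewrite leNgt; apply/negP => h1_lt0.
have := archi_boundP (x := e1 / - h1); rewrite divr_ge0 ?oppr_ge0 ?(ltW h1_lt0)//.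
move=> /(_ isT); set P := Num.bound _; rewrite ltr_pdivrMr ?oppr_gt0// => PP.
have := eh P; rewrite lecE => /andP[_] /=.
rewrite (_ : (P%:R : C) = (P%:R)%:C%C) /=; last by rewrite rmorph_nat.
by rewrite mul0r subr0; lra.
Qed.

(** Converse of [band_form_ge0]: the form on truncated Bloch waves is affine in the number [P] of
    periods, with slope the Bloch form, so its nonnegativity for all [P] makes the slope
    nonnegative. *)
Lemma bloch_ge0 b z w : periodic_diags d b -> banded M b ->
  (forall L x, 0 <= band_form b L x x) ->
  z * z^* = 1 -> (forall i, w (i + d)%N = w i) -> 0 <= bloch b d M z w.
Proof.
move=> pb bb b0 zz pw.
apply: (@nonneg_slope (let x k := z ^+ k * w k in band_form b (M + M) x x)) => P.
by rewrite -(band_form_bloch_wave P pb bb zz pw).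
Qed.

End CircleMaximum.

Section ComplexFunctions.
Context {R : realType} {U : Type} (P : (U -> R) -> Prop).
Hypothesis PR : function_ring P.
Local Notation C := R[i].
Implicit Types f g : U -> C.

Definition complex_fun f := P (fun u => complex.Re (f u)) /\ P (fun u => complex.Im (f u)).

Lemma complex_fun_ext f g : f =1 g -> complex_fun g -> complex_fun f.
Proof. by move=> /funext ->. Qed.

Lemma complex_fun_cst c : complex_fun (fun=> c).
Proof. by split; exact: (function_ring_cst PR). Qed.

Lemma complex_fun_pair (f1 f2 : U -> R) : P f1 -> P f2 ->
  complex_fun (fun u => Complex (f1 u) (f2 u)).
Proof. by []. Qed.

Lemma complex_funD f g : complex_fun f -> complex_fun g ->
  complex_fun (fun u => f u + g u).
Proof.
move=> [f1 f2] [g1 g2]; split.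
  rewrite [X in P X](_ : _ = fun u => complex.Re (f u) + complex.Re (g u)).
    exact: (function_ringD PR).
  by apply/funext => u; case: (f u) (g u) => ? ? [].
rewrite [X in P X](_ : _ = fun u => complex.Im (f u) + complex.Im (g u)).
  exact: (function_ringD PR).
by apply/funext => u; case: (f u) (g u) => ? ? [].
Qed.

Lemma function_ringN (f : U -> R) : P f -> P (fun u => - f u).
Proof.
move=> Pf; rewrite [X in P X](_ : _ = fun u => -1 * f u); last first.
  by apply/funext => u; rewrite mulN1r.
by apply: (function_ringM PR) => //; exact: (function_ring_cst PR).
Qed.

Lemma complex_funM f g : complex_fun f -> complex_fun g ->
  complex_fun (fun u => f u * g u).
Proof.
move=> [f1 f2] [g1 g2]; split.
  rewrite [X in P X](_ : _ = fun u => complex.Re (f u) * complex.Re (g u) +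
      - (complex.Im (f u) * complex.Im (g u))).
    apply: (function_ringD PR); first exact: (function_ringM PR).
    by apply: (@function_ringN (fun u => _ * _)); exact: (function_ringM PR).
  by apply/funext => u; case: (f u) (g u) => ? ? [].
rewrite [X in P X](_ : _ = fun u => complex.Re (f u) * complex.Im (g u) +
    complex.Im (f u) * complex.Re (g u)).
  by apply: (function_ringD PR); exact: (function_ringM PR).
by apply/funext => u; case: (f u) (g u) => ? ? [].
Qed.

Lemma complex_funJ f : complex_fun f -> complex_fun (fun u => (f u)^*).
Proof.
move=> [f1 f2]; split.
  rewrite [X in P X](_ : _ = fun u => complex.Re (f u)) //.
  by apply/funext => u; case: (f u).
rewrite [X in P X](_ : _ = fun u => - complex.Im (f u)); first exact: function_ringN.
by apply/funext => u; case: (f u).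
Qed.

Lemma complex_funX f n : complex_fun f -> complex_fun (fun u => f u ^+ n).
Proof.
move=> cf; elim: n => [|n IH]; first exact: complex_fun_cst.
by under eq_fun do rewrite exprS; exact: complex_funM.
Qed.

Lemma complex_fun_sum (I : Type) (r : seq I) (Q : pred I) (F : I -> U -> C) :
  (forall i, complex_fun (F i)) -> complex_fun (fun u => \sum_(i <- r | Q i) F i u).
Proof.
move=> cF; elim: r => [|i r IH].
  by under eq_fun do rewrite big_nil; exact: complex_fun_cst.
under eq_fun do rewrite big_cons; case: (Q i) => //; exact: complex_funD.
Qed.

Lemma complex_fun_prod (I : Type) (r : seq I) (Q : pred I) (F : I -> U -> C) :
  (forall i, complex_fun (F i)) -> complex_fun (fun u => \prod_(i <- r | Q i) F i u).
Proof.
move=> cF; elim: r => [|i r IH].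
  by under eq_fun do rewrite big_nil; exact: complex_fun_cst.
under eq_fun do rewrite big_cons; case: (Q i) => //; exact: complex_funM.
Qed.

Lemma complex_fun_det n (A : U -> 'M[C]_n) :
  (forall i j, complex_fun (fun u => A u i j)) -> complex_fun (fun u => \det (A u)).
Proof.
move=> cA; apply: complex_fun_sum => s; apply: complex_funM; first exact: complex_fun_cst.
exact: complex_fun_prod.
Qed.

End ComplexFunctions.

Lemma continuous_function_ring {R : realType} (U : topologicalType) :
  function_ring (fun f : U -> R => continuous f).
Proof.
split=> [c|f g cf cg|f g cf cg] u; first exact: cvg_cst.
- by apply: cvgD; [exact: cf|exact: cg].
- by apply: cvgM; [exact: cf|exact: cg].
Qed.

(** * Attainment of the maximum of the Bloch form *)

Section BlochMaximum.
Context {R : realType}.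
Local Notation C := R[i].
Variables (d M : nat).
Implicit Types (b : int -> int -> C) (z : C).

(* The real coordinates of the pair [(z, w)]. *)
Let coords := 'rV[R]_(d.+1 + d.+1).
Let entry (v : coords) (i : nat) : C :=
  Complex (v ord0 (lshift _ (inord i))) (v ord0 (rshift _ (inord i))).

Let cfun := complex_fun (fun f : coords -> R => continuous f).

Let cfun_entry i : cfun (fun v => entry v i).
Proof. by split; exact: coord_continuous. Qed.

(** Compactness of the pairs of a unit [z] and a unit [w]. The real part is maximised because
    nothing makes the form real for a general [b]. *)
Lemma bloch_max b : (0 < d)%N -> exists z w, [/\ z * z^* = 1, sqnorm d w = 1,
  (forall i, w (i + d)%N = w i) &
  forall z' w', z' * z'^* = 1 -> (forall i, w' (i + d)%N = w' i) ->
    sqnorm d w' = 1 ->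
    complex.Re (bloch b d M z' w') <= complex.Re (bloch b d M z w)].
Proof.
move=> d0; have CR := continuous_function_ring (R := R) coords.
pose zc (v : coords) := entry v 0.
pose wc (v : coords) (i : nat) := entry v (i %% d).+1.
pose nz v := complex.Re (zc v * (zc v)^*).
pose nw v := complex.Re (sqnorm d (wc v)).
(* The cube supplies compactness; it is implied by the two normalisations, as [codeK] checks. *)
pose K := [set v : coords | forall i, `[-1, 1]%classic (v ord0 i)] `&`
  (nz @^-1` [set x | x = 1] `&` nw @^-1` [set x | x = 1]).
have cnz : continuous nz.
  by have [] := complex_funM CR (cfun_entry 0) (complex_funJ CR (cfun_entry 0)).
have cnw : continuous nw.
  suff [] : cfun (fun v => sqnorm d (wc v)) by [].
  apply: (complex_fun_sum CR) => i; apply: (complex_funM CR); last apply: (complex_funJ CR).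
    exact: cfun_entry.
  exact: cfun_entry.
pose f v := complex.Re (bloch b d M (zc v) (wc v)).
have cf : continuous f.
  suff [] : cfun (fun v => bloch b d M (zc v) (wc v)) by [].
  apply: (complex_fun_sum CR) => i; apply: (complex_fun_sum CR) => r.
  apply: (complex_funM CR); last by apply: (complex_funJ CR); exact: cfun_entry.
  apply: (complex_funM CR); last exact: cfun_entry.
  apply: (complex_funM CR); first exact: complex_fun_cst.
  apply: (complex_funM CR); apply: (complex_funX CR); last apply: (complex_funJ CR).
    exact: cfun_entry.
  exact: cfun_entry.
have cK : compact K.
  apply: compact_closedI.
    apply: (@rV_compact R _ (fun=> `[-1, 1]%classic)) => _.
    exact: segment_compact.
  apply: closedI; apply: preimage_closed.
  - by move=> v _; exact: cnz.
  - exact: closed_eq.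
  - by move=> v _; exact: cnw.
  - exact: closed_eq.
pose code z w : coords := \row_j
  let u (i : nat) := if i is i'.+1 then w i' else z in
  match fintype.split j with inl i => complex.Re (u i) | inr i => complex.Im (u i) end.
have codeE z w i : (i < d.+1)%N -> entry (code z w) i = if i is i'.+1 then w i' else z.
  move=> id; rewrite /entry !mxE.
  rewrite -[lshift _ _]/(unsplit (inl _)) -[rshift _ _]/(unsplit (inr _)).
  rewrite !unsplitK inordK//.
  by case: i id => [|i] _ /=; [case: z|case: (w i)].
have zcE z w : zc (code z w) = z by rewrite /zc codeE.
have wcE z w i : (forall i, w (i + d)%N = w i) -> wc (code z w) i = w i.
  move=> pw; rewrite /wc codeE ?ltnS ?ltn_mod//.
  by rewrite -(periodic_seqM (i %/ d) pw (i %% d)%N) addnC -divn_eq.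
have Re1 (c : C) : 0 <= c -> complex.Re c = 1 -> c = 1.
  by case: c => x y; rewrite lecE/= => /andP[/eqP-> _] ->.
have sqnorm_ge0 w : 0 <= sqnorm d w by apply: sumr_ge0 => i _; rewrite mul_conjC_ge0.
have small (c : C) : c * c^* <= 1 ->
    `[-1, 1]%classic (complex.Re c) /\ `[-1, 1]%classic (complex.Im c).
  case: c => x y; rewrite lecE/= => /andP[_]; rewrite mulrN opprK => xy.
  by have := sqr_ge0 x; have := sqr_ge0 y; rewrite !in_itv/= => y0 x0;
  split; apply/andP; split; nra.
have codeK z w : z * z^* = 1 -> (forall i, w (i + d)%N = w i) -> sqnorm d w = 1 ->
    K (code z w).
  move=> z1 pw w1; split; last first.
    split; first by rewrite /= /nz zcE z1.
    rewrite /= /nw -[1]/(complex.Re (1 : C)) -w1; congr complex.Re.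
    by apply: eq_bigr => i _; rewrite !wcE.
  have u1 (i : 'I_d.+1) :
      let c := if nat_of_ord i is i'.+1 then w i' else z in c * c^* <= 1.
    case: i => -[|i] /= id; first by rewrite z1.
    have id' : (i < d)%N by [].
    rewrite -w1 /sqnorm (bigD1 (Ordinal id'))//= lerDl.
    by apply: sumr_ge0 => k _; rewrite mul_conjC_ge0.
  move=> j; rewrite mxE; case: (fintype.split j) => i.
    exact: (small _ (u1 i)).1.
  exact: (small _ (u1 i)).2.
have K0 : K !=set0.
  exists (code 1 (fun i => (i %% d == 0)%N%:R)); apply: codeK.
  - by rewrite rmorph1 mulr1.
  - by move=> i; rewrite modnDr.
  - rewrite /sqnorm (bigD1 (Ordinal d0))//= mod0n eqxx -normCK normr1 expr1n big1 ?addr0//.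
    move=> i /negP ine; rewrite modn_small//; case: eqP => [i0|_]; last by rewrite mul0r.
    by exfalso; apply: ine; rewrite -val_eqE/= i0.
have [v vK vmax] := EVT_max_rV K0 cK (continuous_subspaceT cf).
move: vK => /set_mem[_ [/= vz vw]].
exists (zc v), (wc v); split.
- by apply: Re1 => //; rewrite mul_conjC_ge0.
- by apply: Re1; [exact: sqnorm_ge0|exact: vw].
- by move=> i; rewrite /wc modnDr.
move=> z' w' z'1 pw' w'1; have := vmax (code z' w') (mem_set (codeK _ _ z'1 pw' w'1)).
rewrite /f zcE; congr (_ <= _); congr complex.Re.
by apply: eq_bigr => i _; apply: eq_bigr => r _; rewrite !wcE.
Qed.

End BlochMaximum.

(** * The support function is algebraic *)

Section SupportSymbol.
Context {R : realType}.
Local Notation C := R[i].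
Variables (n m : nat).
Implicit Types (b : int -> int -> C) (z : C).
Local Notation d := n.+1.
Local Notation M := (m * d)%N.

Definition is_support b (lam : R) : Prop :=
  (forall L x, 0 <= band_form (shifted lam%:C%C b) L x x) /\
  (forall mu : R, (forall L x, 0 <= band_form (shifted mu%:C%C b) L x x) -> lam <= mu).

Lemma blochZ b z w (t : C) :
  bloch b d M z (fun i => t * w i) = t * t^* * bloch b d M z w.
Proof.
rewrite /bloch mulr_sumr; apply: eq_bigr => j _; rewrite /bloch_row mulr_sumr.
by apply: eq_bigr => r _; rewrite rmorphM/=; ring.
Qed.

Lemma sqnormZ L w (t : C) : sqnorm L (fun i => t * w i) = t * t^* * sqnorm L w.
Proof.
by rewrite /sqnorm mulr_sumr; apply: eq_bigr => j _; rewrite rmorphM/=; ring.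
Qed.

Lemma sqnorm_ge0 L w : 0 <= sqnorm L w :> C.
Proof. by apply: sumr_ge0 => i _; rewrite mul_conjC_ge0. Qed.

Lemma periodic_extE (w : nat -> C) : (forall i, w (i + d)%N = w i) ->
  w = periodic_ext (\col_(i < d) w i).
Proof.
move=> pw; apply/funext => k; rewrite /periodic_ext mxE/=.
by rewrite -(periodic_seqM (k %/ d) pw (k %% d)%N) addnC -divn_eq.
Qed.

Lemma sqnorm_ext_gt0 (v : 'cV[C]_d) : v != 0 -> 0 < sqnorm d (periodic_ext v).
Proof.
move=> v0; rewrite lt0r sqnorm_ge0 andbT sqnorm_periodic_ext.
apply: contraNneq v0 => /psumr_eq0P v0; apply/eqP/matrixP => i j.
rewrite ord1 [RHS]mxE; apply/eqP; rewrite -normr_eq0 -sqrf_eq0.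
by rewrite v0// => k _; rewrite exprn_ge0.
Qed.

(** A kernel vector at [c > lam] would give the Bloch form a normalised value above [lam]. At [lam],
    the maximum [mu] of the Bloch form satisfies [mu <= lam] by [bloch_ge0], and [lam <= mu] by
    [band_form_ge0] and minimality of [lam]; the maximiser is then in the kernel by [psd_kernel]. *)
Lemma support_symbol b lam : periodic_diags d b -> banded M b -> is_support b lam ->
  (exists2 z, z * z^* = 1 & \det (circle_symbol n m (shifted lam%:C%C b) z) = 0) /\
  (forall (c : R) z, lam < c -> z * z^* = 1 ->
     \det (circle_symbol n m (shifted c%:C%C b) z) != 0).
Proof.
move=> pb bb [lam_ge lam_min].
have bloch_lam z w : z * z^* = 1 -> (forall i, w (i + d)%N = w i) ->
    0 <= bloch (shifted lam%:C%C b) d M z w.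
  by apply: bloch_ge0 => //; [exact: periodic_shifted|exact: banded_shifted].
(* Reality is read off positivity, a nonnegative complex number being real. *)
have bloch_real z w : z * z^* = 1 -> (forall i, w (i + d)%N = w i) ->
    bloch b d M z w = (complex.Re (bloch b d M z w))%:C%C.
  move=> zz pw; apply/esym/RRe_real; have := bloch_lam z w zz pw.
  rewrite bloch_shifted// => h.
  have -> : bloch b d M z w =
      lam%:C%C * sqnorm d w - (lam%:C%C * sqnorm d w - bloch b d M z w).
    by ring.
  rewrite rpredB ?rpredM ?(ger0_real h) ?(ger0_real (sqnorm_ge0 _ _))//.
  by apply/complex_realP; exists lam.
split; last first.
  move=> c z lamc zz; apply/negP; rewrite -det_tr => /det0P[v v0 vA].
  have Av : circle_symbol n m (shifted c%:C%C b) z *m v^T = 0.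
    by rewrite -[LHS]trmxK trmx_mul trmxK vA trmx0.
  have vT0 : v^T != 0 by rewrite -(inj_eq trmx_inj) trmxK trmx0.
  have := bloch_symbol m (shifted c%:C%C b) z v^T; rewrite Av.
  rewrite bloch_shifted//; last exact: periodic_extP.
  rewrite big1 => [/eqP|i _]; last by rewrite mxE mul0r.
  rewrite subr_eq0 => /eqP e.
  have := bloch_lam z _ zz (periodic_extP v^T).
  rewrite bloch_shifted//; last exact: periodic_extP.
  rewrite -e -mulrBl pmulr_lge0 ?sqnorm_ext_gt0// subr_ge0 lecR.
  by rewrite leNgt lamc.
have [z [w [zz w1 pw wmax]]] := bloch_max M b (ltn0Sn n).
set mu := complex.Re _ in wmax.
have mu_lam : mu%:C%C <= lam%:C%C.
  have := bloch_lam z w zz pw; rewrite bloch_shifted// w1 mulr1.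
  by rewrite bloch_real// subr_ge0.
have lam_mu : lam <= mu.
  apply: lam_min; apply: (band_form_ge0 (ltn0Sn n) (dvdn_mull m (dvdnn d))
    (periodic_shifted _ pb) (banded_shifted _ bb)).
  move=> z' w' zz' pw'; rewrite bloch_shifted//.
  have [S0|S0] := eqVneq (sqnorm d w') 0.
    have w0 : w' = fun i => 0 * w' i.
      rewrite (periodic_extE pw'); apply/funext => i; rewrite mul0r.
      have [v0|v0] := eqVneq (\col_(i < d) w' i) 0; first by rewrite v0 /periodic_ext mxE.
      by have := sqnorm_ext_gt0 v0; rewrite -(periodic_extE pw') S0 ltxx.
    by rewrite S0 w0 blochZ mul0r mul0r mulr0 subr0.
  have Sgt0 : 0 < sqnorm d w' by rewrite lt0r S0 sqnorm_ge0.
  pose t := sqrtC (sqnorm d w')^-1.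
  have tt : t * t^* = (sqnorm d w')^-1.
    rewrite -normCK ger0_norm ?sqrtCK// sqrtC_ge0 invr_ge0; exact: ltW.
  have pw'' i : t * w' (i + d)%N = t * w' i by rewrite pw'.
  have := wmax z' (fun i => t * w' i) zz' pw''.
  rewrite sqnormZ tt mulVf// => /(_ erefl).
  rewrite -lecR -bloch_real// blochZ tt mulrC ler_pdivrMr//.
  by rewrite subr_ge0.
exists z => //; have e : mu%:C%C = lam%:C%C.
  by apply/le_anti; rewrite mu_lam lecR.
rewrite -det_tr; apply/eqP/det0P; exists (\col_(i < d) w i)^T.
  apply: contraTneq isT => /(congr1 trmx); rewrite trmxK trmx0 => v0.
  have := w1; rewrite (periodic_extE pw) v0 sqnorm_periodic_ext big1 => [/esym/eqP|i _].
    by rewrite oner_eq0.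
  by rewrite mxE normr0 expr0n.
rewrite -trmx_mul; apply/(canLR trmxK); rewrite trmx0.
apply: psd_kernel => [u|]; rewrite -bloch_symbol.
  by apply: bloch_lam => //; exact: periodic_extP.
rewrite -periodic_extE// bloch_shifted// w1 mulr1 bloch_real// -/mu e.
by rewrite subrr.
Qed.

End SupportSymbol.

(** * Real parametrisation of the circle and elimination of its variable *)

Section PolynomialSymbol.
Context {R : realType}.
Local Notation C := R[i].
Variables (n m : nat).
Implicit Types (b : int -> int -> C) (z : C).
Local Notation d := n.+1.
Local Notation M := (m * d)%N.

Let lift (t : R) : C := (Complex 1 t) ^+ 2.

Let lift_neq0 t : lift t != 0.
Proof. by rewrite expf_neq0// eq_complex/= oner_eq0. Qed.

Let liftJ_neq0 t : (lift t)^* != 0.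
Proof. by rewrite conjC_eq0. Qed.

(* The square of the Cayley transform is onto the unit circle: a square root of
   [z] can be chosen different from [-1]. *)
Lemma circle_lift z : z * z^* = 1 -> exists t, z = lift t / (lift t)^*.
Proof.
move=> zz; pose y := sqrtC z.
have yz : y ^+ 2 = z by rewrite sqrtCK.
have yy : y * y^* = 1.
  have /eqP z1 : `|z| == 1 by rewrite -(pexpr_eq1 (n := 2))// normCK zz.
  by rewrite -normCK -normrX yz.
have [y1|y1] := eqVneq (1 + y) 0.
  exists 0; rewrite /lift -yz; have -> : y = - 1 by rewrite -[y](addKr 1) y1 addr0.
  have -> : Complex 1 0 = 1 :> C by [].
  by rewrite rmorphXn rmorph1 !expr1n divr1 sqrrN expr1n.
have yJ : 1 + y^* != 0 by rewrite -[1]conjC1 -rmorphD conjC_eq0.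
have [t [r [r0 rR tE]]] : exists t : R, exists r : C,
    [/\ r != 0, r^* = r & Complex 1 t = r * (1 + y)].
  case: y {yz yJ} yy y1 => p q [pq _] y1.
  have p1 : 1 + p != 0.
    apply: contraNneq y1 => p1; have pE : p = -1 by rewrite -[p](addKr 1) p1 addr0.
    have q0 : q = 0.
      by apply/eqP; rewrite -sqrf_eq0; apply/eqP; move: pq; rewrite pE; lra.
    by rewrite eq_complex/= pE q0 addrN addr0 eqxx.
  exists (q / (1 + p)), (1 + p)^-1%:C%C; split.
  - by rewrite eq_complex/= eqxx andbT invr_eq0.
  - exact: conjc_real.
  - by apply/eqP; rewrite eq_complex/= !mul0r subr0 addr0 add0r mulVf// mulrC !eqxx.
exists t; rewrite /lift tE -yz rmorphXn rmorphM rmorphD rmorph1/= rR -expr_div_n.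
congr (_ ^+ 2); have -> : 1 + y = y * (1 + y^* ) by rewrite mulrDr yy mulr1 addrC.
by field; rewrite r0 yJ.
Qed.

(** With [u = lift t], the power [(u / conj u) ^ (r - M)] times [|u| ^ (2 M)] is
    [u ^ r * conj u ^ (2 M - r)]: clearing denominators makes the symbol polynomial in the real
    variable [t]. *)
Definition poly_symbol b (t : R) : 'M[C]_d :=
  symbol n m b (fun r => lift t ^+ r * (lift t)^* ^+ (M.*2 - r)).

Lemma poly_symbolE b t :
  poly_symbol b t =
  (lift t * (lift t)^*) ^+ M *: circle_symbol n m b (lift t / (lift t)^*).
Proof.
apply/matrixP => i k; rewrite !mxE mulr_sumr; apply: eq_bigr => r _.
have := liftJ_neq0 t; have := lift_neq0 t; move: (lift t) => u u0 u0'.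
have -> : (u / u^*)^* = u^* / u by rewrite rmorphM fmorphV/= conjCK.
have e : u^* ^+ (M.*2 - r) = u^* ^+ M * u^* ^+ M / u^* ^+ r.
  apply: (canRL (mulfK _)); first by rewrite expf_neq0.
  by rewrite -!exprD subnK; [rewrite addnn|rewrite -ltnS].
rewrite e !expr_div_n exprMn; have := expf_neq0 M u0; have := expf_neq0 r u0'.
by move=> x4 x1; field; rewrite x1 x4.
Qed.

Lemma det_poly_symbol b t : (\det (poly_symbol b t) == 0) =
  (\det (circle_symbol n m b (lift t / (lift t)^*)) == 0).
Proof.
rewrite poly_symbolE detZ mulf_eq0 expf_eq0 expf_eq0 mulf_eq0.
by rewrite !(negbTE (lift_neq0 t), negbTE (liftJ_neq0 t)) !andbF.
Qed.

Lemma lift_circle t : lift t / (lift t)^* * (lift t / (lift t)^*)^* = 1.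
Proof.
have := liftJ_neq0 t; have := lift_neq0 t; move: (lift t) => u u0 u0'.
by rewrite rmorphM fmorphV/= conjCK; field; rewrite u0 u0'.
Qed.

Lemma polyfun3_det_symbol (a1 a2 : int -> int -> C) (sigma : R) :
  complex_fun polyfun3 (fun u : R * R * R =>
    \det (poly_symbol (shifted u.1.2%:C%C
      (fun r j => u.2%:C%C * a1 r j + sigma%:C%C * a2 r j)) u.1.1)).
Proof.
have PR := @polyfun3_ring R; apply: (complex_fun_det PR) => i k.
apply: (complex_fun_ext (g := fun u : R * R * R => \sum_(r < M.*2.+1)
  (k == inZp (i + r))%:R * (shifted u.1.2%:C%C
    (fun r j => u.2%:C%C * a1 r j + sigma%:C%C * a2 r j) (r%:Z - M%:Z) i%:Z *
   (lift u.1.1 ^+ r * (lift u.1.1)^* ^+ (M.*2 - r))))) => [u|].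
  by rewrite mxE.
have c0 : polyfun3 (fun=> 0 : R) by exact: function_ring_cst.
have clift : complex_fun polyfun3 (fun u : R * R * R => lift u.1.1).
  apply: (complex_funX PR); apply: complex_fun_pair; last exact: polyfun3_1.
  exact: function_ring_cst.
apply: (complex_fun_sum PR) => r; apply: (complex_funM PR).
  exact: complex_fun_cst.
apply: (complex_funM PR); last first.
  by apply: (complex_funM PR); apply: (complex_funX PR) => //; exact: complex_funJ.
apply: (complex_funD PR).
  apply: (complex_funM PR); last exact: complex_fun_cst.
  by apply: complex_fun_pair => //; exact: polyfun3_2.
rewrite [X in complex_fun _ X](_ : _ = fun u : R * R * R =>
  -1 * (u.2%:C%C * a1 (r%:Z - M%:Z) i%:Z + sigma%:C%C * a2 (r%:Z - M%:Z) i%:Z));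
  last by apply/funext => u; rewrite mulN1r.
apply: (complex_funM PR); first exact: complex_fun_cst.
apply: (complex_funD PR); last exact: complex_fun_cst.
apply: (complex_funM PR); last exact: complex_fun_cst.
by apply: complex_fun_pair => //; exact: polyfun3_3.
Qed.

Lemma support_algebraic (a1 a2 : int -> int -> C) (sigma : R) (lam : R -> R) :
  periodic_diags d a1 -> periodic_diags d a2 -> banded M a1 -> banded M a2 ->
  (forall s, is_support (fun r j => s%:C%C * a1 r j + sigma%:C%C * a2 r j) (lam s)) ->
  exists2 Q : {poly {poly R}}, Q != 0 & forall s, ev2 (lam s) s Q = 0.
Proof.
move=> p1 p2 b1 b2 lamP.
pose a s r j : C := s%:C%C * a1 r j + sigma%:C%C * a2 r j.
have pa s : periodic_diags d (a s) by move=> r j; rewrite /a p1 p2.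
have ba s : banded M (a s) by move=> r j rM; rewrite /a b1// b2// !mulr0 addr0.
have [[D1 hD1] [D2 hD2]] := polyfun3_det_symbol a1 a2 sigma.
(* One real equation for the vanishing of a complex determinant. *)
pose D := D1 * D1 + D2 * D2.
have hD t c s : (ev3 D t c s == 0) =
    (\det (circle_symbol n m (shifted c%:C%C (a s)) (lift t / (lift t)^*)) == 0).
  rewrite -det_poly_symbol ev3D !ev3M (hD1 (t, c, s)) (hD2 (t, c, s)) /=.
  set e := \det _; rewrite -!expr2 paddr_eq0 ?sqr_ge0// !sqrf_eq0.
  by rewrite [RHS]eq_complex.
have D0 : D != 0.
  have [_ /(_ (lam 0 + 1))] := support_symbol (pa 0) (ba 0) (lamP 0).
  move=> /(_ (lift 0 / (lift 0)^*)); rewrite ltrDl ltr01 => /(_ isT (lift_circle 0)).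
  by rewrite -hD; apply: contraNneq => ->; rewrite ev3E horner0 raddf0.
have [Q Q0 hQ] := thin_extremal_root 1 D0; exists Q => // s; apply: hQ.
have [[z zz detz] nz] := support_symbol (pa s) (ba s) (lamP s).
(* Any radius would do, here [1]: beyond [lam s] the symbol is nonsingular on the whole circle. *)
have [t zt] := circle_lift zz; exists t, 1; split => //.
  by apply/eqP; rewrite hD -zt detz.
move=> t' h _ /andP[h0 _]; rewrite hD mul1r nz//; first by rewrite ltrDl.
exact: lift_circle.
Qed.

End PolynomialSymbol.

(** * Numerical range on finitely supported vectors *)

Section FiniteRange.
Context {R : realType}.
Local Notation C := R[i].
Variables (n m : nat).
Implicit Types (a b : int -> int -> C) (z : C) (p q : R * R).
Local Notation d := n.+1.
Local Notation M := (m * d)%N.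

Definition form_point b L x : R * R :=
  (complex.Re (band_form b L x x), complex.Im (band_form b L x x)).

Definition fin_range b : set (R * R) :=
  [set p | exists L x, sqnorm L x = 1 /\ p = form_point b L x].

Lemma band_formZ b L x (t : C) :
  band_form b L (fun i => t * x i) (fun i => t * x i) = t * t^* * band_form b L x x.
Proof.
rewrite /band_form mulr_sumr; apply: eq_bigr => j _; rewrite mulr_sumr.
by apply: eq_bigr => k _; rewrite rmorphM/=; ring.
Qed.

Lemma band_form_lin a b (s t : C) L x :
  band_form (fun r j => s * a r j + t * b r j) L x x =
  s * band_form a L x x + t * band_form b L x x.
Proof.
rewrite /band_form !mulr_sumr -big_split; apply: eq_bigr => j _ /=.
by rewrite !mulr_sumr -big_split; apply: eq_bigr => k _ /=; ring.
Qed.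

(** Lets [band_form_concat] control the norm and the form of one and the same vector. *)
Lemma sqnorm_band_form L x : sqnorm L x = band_form (shifted 1 (fun _ _ => 0)) L x x :> C.
Proof.
rewrite band_form_shifted mul1r [X in _ - X]big1 ?subr0// => j _.
by rewrite big1// => k _; rewrite !mul0r.
Qed.

(* Translating [y] by a large multiple of the period leaves its form unchanged
   and removes all interaction with [x]. *)
Lemma band_form_concat (s t : C) L1 (x : nat -> C) L2 (y : nat -> C) :
  exists L (z : nat -> C), forall b,
  periodic_diags d b -> banded M b ->
  band_form b L z z = s * s^* * band_form b L1 x x + t * t^* * band_form b L2 y y.
Proof.
pose S := ((L1 + M) * d)%N.
have SL : (L1 + M <= S)%N by rewrite /S leq_pmulr.
exists (S + L2)%N, (fun k => if (k < L1)%N then s * x k else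
                     if (S <= k)%N then t * y (k - S)%N else 0) => b pb bb.
set z := fun k : nat => _.
have z1 k : (L1 <= k < S)%N -> z k = 0.
  by move=> /andP[k1 k2]; rewrite /z ltnNge k1/= leqNgt k2.
have z2 k : z (S + k)%N = t * y k.
  by rewrite /z ltnNge (leq_trans _ (leq_addr _ _)) ?leq_addr ?addKn//; lia.
have z3 k : (k < L1)%N -> z k = s * x k by rewrite /z => ->.
rewrite -!band_formZ /band_form big_split_ord/=; congr (_ + _).
  rewrite (@sum_widen _ L1 S
    (fun j => \sum_(k < S + L2) b (k%:Z - j%:Z) j%:Z * z k * (z j)^*)).
  - apply: eq_bigr => j _; rewrite big_split_ord/= [X in _ + X]big1 ?addr0; last first.
      by move=> k _; rewrite bb ?mul0r//; have := ltn_ord j; lia.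
    rewrite (@sum_widen _ L1 S (fun k => b (k%:Z - j%:Z) j%:Z * z k * (z j)^*)).
    + by apply: eq_bigr => k _; rewrite !z3.
    + lia.
    + by move=> k kL; rewrite (z1 k kL) mulr0 mul0r.
  - lia.
  - by move=> j jL; rewrite big1// => k _; rewrite (z1 j jL) conjC0 mulr0.
apply: eq_bigr => j _; rewrite big_split_ord/= big1 ?add0r; last first.
  move=> k _; have [kL|kL] := leqP L1 k; first by rewrite z1 ?kL ?ltn_ord// mulr0 mul0r.
  by rewrite bb ?mul0r//; lia.
apply: eq_bigr => k _; rewrite !z2 (_ : _ - _ = k%:Z - j%:Z); last by lia.
rewrite (_ : (S + j)%N%:Z = j%:Z + S%:Z); last by lia.
by rewrite periodicM.
Qed.

Lemma band_form_eq0 b L x : sqnorm L x = 0 -> band_form b L x x = 0.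
Proof.
move=> S0; have x0 (k : 'I_L) : x k = 0.
  apply/eqP; rewrite -mul_conjC_eq0; apply/eqP.
  apply: (psumr_eq0P (F := fun k : 'I_L => x k * (x k)^*)) S0 k isT.
  by move=> i _; rewrite mul_conjC_ge0.
rewrite /band_form big1// => j _; rewrite big1// => k _.
by rewrite x0 mulr0 mul0r.
Qed.

Lemma form_point_scale b L x : sqnorm L x != 0 -> exists2 p, fin_range b p &
  forall u v, u * complex.Re (band_form b L x x) + v * complex.Im (band_form b L x x) =
              complex.Re (sqnorm L x) * (u * p.1 + v * p.2).
Proof.
move=> S0; have Sgt0 : 0 < sqnorm L x by rewrite lt0r S0 sqnorm_ge0.
pose t := sqrtC (sqnorm L x)^-1.
have tt : t * t^* = (sqnorm L x)^-1.
  rewrite -normCK ger0_norm ?sqrtCK// sqrtC_ge0 invr_ge0; exact: ltW.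
exists (form_point b L (fun i => t * x i)).
  by exists L, (fun i => t * x i); rewrite sqnormZ tt mulVf.
move=> u v; rewrite /form_point band_formZ tt.
have SE : sqnorm L x = (complex.Re (sqnorm L x))%:C%C.
  by apply/esym/RRe_real/ger0_real/ltW.
have Re0 : complex.Re (sqnorm L x) != 0.
  by apply: contraNneq S0; rewrite {2}SE => ->.
rewrite SE -fmorphV/=; case: (band_form _ _ _ _) => f1 f2 /=.
by field.
Qed.

Lemma fin_range_convex b p q t : periodic_diags d b -> banded M b ->
  fin_range b p -> fin_range b q -> 0 <= t <= 1 ->
  fin_range b (t * p.1 + (1 - t) * q.1, t * p.2 + (1 - t) * q.2).
Proof.
move=> pb bb [L1 [x [x1 ->]]] [L2 [y [y1 ->]]] /andP[t0 t1].
(* Weights with squares [t] and [1 - t], on two vectors without interaction. *)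
have [L [z zE]] := band_form_concat (Num.sqrt t)%:C%C (Num.sqrt (1 - t))%:C%C L1 x L2 y.
have sq (r : R) : 0 <= r -> (Num.sqrt r)%:C%C * ((Num.sqrt r)%:C%C)^* = r%:C%C.
  move=> r0; rewrite [_^*](_ : _ = (Num.sqrt r)%:C%C); last exact: conjc_real.
  by rewrite -rmorphM/= -expr2 sqr_sqrtr.
have t1' : 0 <= 1 - t by rewrite subr_ge0.
exists L, z; split.
  rewrite sqnorm_band_form zE; last 2 first.
  - exact: periodic_shifted.
  - exact: banded_shifted.
  by rewrite !sq// -!sqnorm_band_form x1 y1 !mulr1 -rmorphD/= addrC subrK.
rewrite /form_point (zE b)// !sq//.
case: (band_form b L1 _ _) (band_form b L2 _ _) => f1 f2 [g1 g2] /=.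
by congr (_, _); ring.
Qed.

Lemma fin_range_nonempty b : fin_range b !=set0.
Proof.
exists (form_point b 1 (fun=> 1)), 1%N, (fun=> 1); split => //.
by rewrite /sqnorm big_ord1 rmorph1 mulr1.
Qed.

End FiniteRange.

(** * Support function of the numerical range *)

Section SupportPoints.
Context {R : realType}.
Local Notation C := R[i].
Variables (n m : nat) (a : int -> int -> C) (B : R).
Local Notation d := n.+1.
Local Notation M := (m * d)%N.
Hypothesis pa : periodic_diags d a.
Hypothesis ba : banded M a.
Hypothesis aB : forall p, fin_range a p -> `|p.1| <= B /\ `|p.2| <= B.

(** The entry [(j, k)] of the adjoint is the conjugate of the entry [(k, j)], which lies on the
    diagonal [j - k = - r] in row [k = j + r]. *)
Let adj (r j : int) : C := (a (- r) (j + r))^*.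
Let re_part (r j : int) : C := 2^-1 * a r j + 2^-1 * adj r j.
Let im_part (r j : int) : C := (2 * 'i)^-1 * a r j + - (2 * 'i)^-1 * adj r j.

Let band_form_adj L x : band_form adj L x x = (band_form a L x x)^*.
Proof.
rewrite /band_form rmorph_sum [RHS](_ : _ =
    \sum_(j < L) \sum_(k < L) (a (k%:Z - j%:Z) j%:Z * x k * (x j)^*)^*).
  rewrite exchange_big/=; apply: eq_bigr => j _; apply: eq_bigr => k _.
  by rewrite /adj !rmorphM/= conjCK opprB addrCA subrr addr0; ring.
by apply: eq_bigr => j _; rewrite rmorph_sum.
Qed.

Let band_form_re L x : band_form re_part L x x = (complex.Re (band_form a L x x))%:C%C.
Proof. by rewrite band_form_lin band_form_adj complexRe ReE; field. Qed.

Let band_form_im L x : band_form im_part L x x = (complex.Im (band_form a L x x))%:C%C.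
Proof.
rewrite band_form_lin band_form_adj complexIm ImE; have i0 : 'i != 0 :> C := neq0Ci _.
have ii : 'i ^+ 2 = -1 :> C := sqrCi _.
move: (band_form _ _ _ _) (_^*) => f g.
have -> : 'i * (g - f) / 2 = 'i * 'i * (g - f) / (2 * 'i) :> C by field.
by rewrite -expr2 ii; field.
Qed.

Let lam (u v : R) : R := sup [set u * p.1 + v * p.2 | p in fin_range a].

Let has_sup_lam u v : has_sup [set u * p.1 + v * p.2 | p in fin_range a].
Proof.
split.
  by have [p ap] := fin_range_nonempty a; exists (u * p.1 + v * p.2), p.
exists (`|u| * B + `|v| * B) => _ [p ap <-]; have [p1 p2] := aB ap.
by apply: lerD; apply: le_trans (ler_norm _) _; rewrite normrM ler_wpM2l.
Qed.

Let lam_ub u v p : fin_range a p -> u * p.1 + v * p.2 <= lam u v.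
Proof. by move=> ap; apply: sup_upper_bound; [exact: has_sup_lam|exists p]. Qed.

Let lam_le u v mu : (forall p, fin_range a p -> u * p.1 + v * p.2 <= mu) ->
  lam u v <= mu.
Proof.
move=> h; apply: ge_sup; first exact: (has_sup_lam u v).1.
by move=> _ [p ap <-]; exact: h.
Qed.

Let is_support_lam s v :
  is_support (fun r j => s%:C%C * re_part r j + v%:C%C * im_part r j) (lam s v).
Proof.
have E mu L x : band_form (shifted mu%:C%C
      (fun r j => s%:C%C * re_part r j + v%:C%C * im_part r j)) L x x =
    (mu * complex.Re (sqnorm L x) - (s * complex.Re (band_form a L x x) +
      v * complex.Im (band_form a L x x)))%:C%C.
  rewrite band_form_shifted band_form_lin band_form_re band_form_im.
  have SR : (complex.Re (sqnorm L x))%:C%C = sqnorm L x.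
    by apply: RRe_real; apply: ger0_real; exact: sqnorm_ge0.
  by rewrite rmorphB rmorphD !rmorphM/= SR.
split=> [L x|mu h].
  rewrite E ler0c subr_ge0.
  have S0 := sqnorm_ge0 L x; have [S0'|Sn0] := eqVneq (sqnorm L x) 0.
    by rewrite S0' (band_form_eq0 _ S0')/= !mulr0 addr0.
  have [p ap ->] := form_point_scale a Sn0.
  rewrite mulrC ler_wpM2r ?lam_ub//.
  by move: S0; rewrite lecE => /andP[].
apply: lam_le => _ [L [x [x1 ->]]] /=.
by have := h L x; rewrite E ler0c x1 mulr1 subr_ge0.
Qed.

(** A supremum of affine functions of [s] whose slopes [p.1] are bounded by [B]. *)
Let lam_lipschitz v s s' : `|lam s v - lam s' v| <= B * `|s - s'|.
Proof.
have half s1 s2 : lam s1 v - lam s2 v <= B * `|s1 - s2|.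
  rewrite lerBlDr; apply: lam_le => p ap.
  have -> : s1 * p.1 + v * p.2 = (s1 - s2) * p.1 + (s2 * p.1 + v * p.2) by ring.
  apply: lerD; last exact: lam_ub.
  apply: le_trans (ler_norm _) _; rewrite normrM mulrC ler_wpM2r//.
  by case: (aB ap).
by rewrite ler_norml half andbT lerNl opprB distrC half.
Qed.

Let thin_vertical (c : R) : thin (fun x _ => x = c).
Proof.
exists ('X - c%:P%:P); first by rewrite polyXsubC_eq0.
by move=> x y ->; rewrite ev2E !hornerE/= subrr.
Qed.

(** The first conjunct gives a supporting line through the point, the second places the point in the
    closed convex hull of the finite range. Dividing the functional by [|v|], or by [|u|] when
    [v = 0], leaves the two signs [sigma] and two vertical lines. *)
Lemma thin_support_points : thin (fun x y =>
  (exists u v, (u != 0 \/ v != 0) /\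
     forall p, fin_range a p -> u * p.1 + v * p.2 <= u * x + v * y) /\
  (forall u v mu, (forall p, fin_range a p -> u * p.1 + v * p.2 <= mu) ->
     u * x + v * y <= mu)).
Proof.
have padj : periodic_diags d adj by move=> r j; rewrite /adj addrAC pa.
have badj : banded M adj.
  by move=> r j rM; rewrite /adj ba ?conjC0// normrN.
have pre : periodic_diags d re_part by move=> r j; rewrite /re_part pa padj.
have pim : periodic_diags d im_part by move=> r j; rewrite /im_part pa padj.
have bre : banded M re_part.
  by move=> r j rM; rewrite /re_part ba// badj// !mulr0 addr0.
have bim : banded M im_part.
  by move=> r j rM; rewrite /im_part ba// badj// !mulr0 addr0.
have tangent (sigma : R) : sigma ^+ 2 = 1 ->
    thin (fun x y => (exists s, lam s sigma = s * x + sigma * y) /\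
                     forall s, s * x + sigma * y <= lam s sigma).
  move=> s1; have [Q Q0 hQ] := support_algebraic pre pim bre bim
    (fun s => is_support_lam s sigma).
  exact: thin_tangent s1 (lam_lipschitz sigma) Q0 hQ.
have t1 := tangent 1 (expr1n _ _).
have tN1 := tangent (-1) (etrans (sqrrN _) (expr1n _ _)).
apply: sub_thin (thinU (thinU t1 tN1)
  (thinU (thin_vertical (lam 1 0)) (thin_vertical (- lam (-1) 0)))).
move=> x y [[u [v [uv sup_uv]]] hull].
have le_lam u' v' : u' * x + v' * y <= lam u' v'.
  by apply: hull => p ap; exact: lam_ub.
have scale (r : R) u' v' : 0 < r -> u = r * u' -> v = r * v' ->
    lam u' v' = u' * x + v' * y.
  move=> r0 ue ve; apply/le_anti; rewrite le_lam andbT; apply: lam_le => p ap.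
  rewrite -(ler_pM2l r0) !mulrDr !mulrA -ue -ve; exact: sup_uv.
have [v0|v0|v0] := ltrgtP v 0.
- left; right; split=> [|s]; last exact: le_lam.
  exists (u / - v); apply: (scale (- v)); rewrite ?oppr_gt0//.
    by rewrite mulrC divfK// oppr_eq0 lt_eqF.
  by rewrite mulrNN mulr1.
- left; left; split=> [|s]; last exact: le_lam.
  exists (u / v); apply: (scale v); rewrite ?mulr1//.
  by rewrite mulrC divfK// gt_eqF.
right; rewrite v0 eqxx in uv.
have u0 : u != 0 by case: uv.
have [u1|u1|u1] := ltrgtP u 0; last by rewrite u1 eqxx in u0.
- right; have -> : lam (-1) 0 = -1 * x + 0 * y.
    by apply: (scale (- u)); rewrite ?oppr_gt0 ?mulr0 ?mulrN1 ?opprK.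
  by rewrite mulN1r mul0r addr0 opprK.
left; have -> : lam 1 0 = 1 * x + 0 * y by apply: (scale u); rewrite ?mulr0 ?mulr1.
by rewrite mul1r mul0r addr0.
Qed.

End SupportPoints.

(** * Supporting lines in the plane *)

Section PlaneSeparation.
Context {R : realType}.
Variables (K : set (R * R)) (p : R * R).
Hypothesis convexK : forall q r t, K q -> K r -> 0 <= t <= 1 ->
  K (t * q.1 + (1 - t) * r.1, t * q.2 + (1 - t) * r.2).

Let supported := exists u v, (u != 0 \/ v != 0) /\
  forall q, K q -> u * q.1 + v * q.2 <= u * p.1 + v * p.2.

(* One-dimensional Hahn-Banach: with [al], [be] the coordinates along and across
   [b], a functional [al - k * be] is nonpositive on [K - p] for every [k] between
   the slopes [al / be] over [be > 0] and those over [be < 0]. *)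
Lemma missed_ray_supported (b1 b2 : R) : (b1 != 0) || (b2 != 0) ->
  (forall t, 0 < t -> ~ K (p.1 + t * b1, p.2 + t * b2)) -> supported.
Proof.
move=> b0 noray.
pose N := b1 ^+ 2 + b2 ^+ 2.
have N0 : 0 < N.
  by rewrite lt0r addr_ge0 ?sqr_ge0// andbT paddr_eq0 ?sqr_ge0// !sqrf_eq0 negb_and.
pose al (q : R * R) := (q.1 - p.1) * b1 + (q.2 - p.2) * b2.
pose be (q : R * R) := (q.1 - p.1) * b2 - (q.2 - p.2) * b1.
have al_le0 q : K q -> be q = 0 -> al q <= 0.
  move=> Kq be0; rewrite leNgt; apply/negP => al0.
  apply: (noray (al q / N)); first exact: divr_gt0.
  have e1 : N * (q.1 - p.1) = al q * b1 + be q * b2 by rewrite /N /al /be; ring.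
  have e2 : N * (q.2 - p.2) = al q * b2 - be q * b1 by rewrite /N /al /be; ring.
  rewrite (_ : (_, _) = q)//; case: q Kq {al0} be0 e1 e2 => q1 q2 /= _ ->.
  rewrite !mul0r subr0 addr0 => e1 e2; congr (_, _).
    by rewrite mulrAC -e1 mulrAC divff ?mul1r ?gt_eqF//; ring.
  by rewrite mulrAC -e2 mulrAC divff ?mul1r ?gt_eqF//; ring.
have slopes q r : K q -> K r -> 0 < be q -> be r < 0 -> al q / be q <= al r / be r.
  move=> Kq Kr bq br.
  have bqr : 0 < be q - be r by rewrite subr_gt0 (lt_trans br).
  (* The point of the segment from [r] to [q] on the line through [p] along [b], where [al] is
     nonpositive. *)
  pose t := - be r / (be q - be r).
  have t01 : 0 <= t <= 1.
    apply/andP; split; first by rewrite divr_ge0 ?oppr_ge0 ?ltW.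
    by rewrite ler_pdivrMr// mul1r lerDr ltW.
  have := al_le0 _ (convexK Kq Kr t01).
  have tE : t * (be q - be r) = - be r by rewrite divfK// gt_eqF.
  rewrite [be _](_ : _ = t * (be q - be r) + be r); last by rewrite /be /=; ring.
  rewrite [al _](_ : _ = t * (al q - al r) + al r); last by rewrite /al /=; ring.
  rewrite tE addrC subrr => /(_ erefl) h.
  rewrite ler_pdivrMr// mulrAC ler_ndivlMr//.
  by have := ler_wpM2r (ltW bqr) h; rewrite mul0r mulrDl mulrAC tE; lra.
(* If [K] lies on one side of the line along [b], that line itself supports it. *)
have [[q0 [Kq0 bq0]]|nopos] := pselect (exists q, K q /\ 0 < be q); last first.
  exists b2, (- b1); split; first by rewrite oppr_eq0; case/orP: b0; [right|left].
  move=> q Kq; have := nopos; rewrite leNgt => h; apply/negP => l; apply: h.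
  by exists q; split => //; rewrite /be; lra.
have [[r0 [Kr0 br0]]|noneg] := pselect (exists q, K q /\ be q < 0); last first.
  exists (- b2), b1; split; first by rewrite oppr_eq0; case/orP: b0; [right|left].
  move=> q Kq; have := noneg; rewrite leNgt => h; apply/negP => l; apply: h.
  by exists q; split => //; rewrite /be; lra.
pose S := [set x | exists2 q, K q /\ 0 < be q & x = al q / be q].
have supS : has_sup S.
  split; first by exists (al q0 / be q0), q0.
  by exists (al r0 / be r0) => _ [q [Kq bq] ->]; exact: slopes.
pose k := sup S.
exists (b1 - k * b2), (b2 + k * b1); split.
  apply: contrapT => /not_orP[/negP/negPn/eqP u0 /negP/negPn/eqP v0].
  have : N = 0.
    transitivity ((b1 - k * b2) * b1 + (b2 + k * b1) * b2); first by rewrite /N; ring.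
    by rewrite u0 v0 !mul0r addr0.
  by apply/eqP; rewrite gt_eqF.
move=> q Kq; suff : al q - k * be q <= 0 by rewrite /al /be; lra.
rewrite subr_le0; have [bq|bq|bq] := ltrgtP (be q) 0.
- rewrite -ler_ndivlMr//; apply: ge_sup; first exact: supS.1.
  by move=> _ [r [Kr br] ->]; exact: slopes.
- by rewrite -ler_pdivrMr//; apply: sup_upper_bound => //; exists q.
- by rewrite bq mulr0; exact: al_le0.
Qed.

(** If no line through [p] supports [K], every ray from [p] meets [K] by [missed_ray_supported]; the
    points found on the four axis rays span a quadrilateral around [p]. *)
Lemma separation_plane :
  ~ (exists2 e : R, 0 < e & forall q : R * R,
       `|q.1 - p.1| < e -> `|q.2 - p.2| < e -> K q) -> supported.
Proof.
move=> noball; apply: contrapT => nosup; apply: noball.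
have ray (b1 b2 : R) : (b1 != 0) || (b2 != 0) ->
    exists2 t, 0 < t & K (p.1 + t * b1, p.2 + t * b2).
  move=> b0; apply: contrapT => nt; apply: nosup.
  by apply: missed_ray_supported b0 _ => t t0 Kt; apply: nt; exists t.
have N1 : -1 != 0 :> R by rewrite oppr_eq0 oner_eq0.
have [|t1 t10 K1] := ray 1 0; first by rewrite oner_eq0.
have [|t2 t20 K2] := ray (-1) 0; first by rewrite N1.
have [|t3 t30 K3] := ray 0 1; first by rewrite oner_eq0 orbT.
have [|t4 t40 K4] := ray 0 (-1); first by rewrite N1 orbT.
rewrite !mulr0 !mulr1 !mulrN1 !addr0 in K1 K2 K3 K4.
have seg (s1 s2 x : R) : 0 < s1 -> 0 < s2 -> `|x| < Num.min s1 s2 -> exists2 t,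
    0 <= t <= 1 & t * s1 - (1 - t) * s2 = x.
  move=> s10 s20; rewrite lt_min !ltr_norml => /andP[/andP[xl1 xr1] /andP[xl2 xr2]].
  have s0 : 0 < s1 + s2 by exact: addr_gt0.
  exists ((x + s2) / (s1 + s2)); last by field; rewrite gt_eqF.
  apply/andP; split; first by apply: divr_ge0; lra.
  by rewrite ler_pdivrMr//; lra.
(* Halved because [q] is the midpoint of a point of the horizontal segment and one of the vertical
   segment, each at twice the corresponding offset of [q]. *)
pose e := Num.min (Num.min t1 t2) (Num.min t3 t4) / 2.
have e0 : 0 < Num.min (Num.min t1 t2) (Num.min t3 t4) by rewrite !lt_min t10 t20 t30.
exists e => [|q]; first exact: divr_gt0.
rewrite !ltr_pdivlMr// => h1 h2.
have two (x : R) : `|x| * 2 = `|x * 2| by rewrite normrM (ger0_norm (x := 2)).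
rewrite !two !lt_min in h1 h2.
case/andP: h1 => h1 _; case/andP: h2 => _ h2; rewrite -!lt_min in h1 h2.
have [t t01 tE] := seg _ _ _ t10 t20 h1.
have [s s01 sE] := seg _ _ _ t30 t40 h2.
have KA := convexK K1 K2 t01; have KB := convexK K3 K4 s01.
have half01 : 0 <= (2^-1 : R) <= 1 by lra.
have := convexK KA KB half01; rewrite /=.
rewrite (_ : (_, _) = q)//; case: q tE sE {h1 h2} => q1 q2 /= tE sE.
by congr (_, _); lra.
Qed.

End PlaneSeparation.

(** * Reduction of the operator to its form on finite vectors *)

Section FiniteVectors.
Context {R : realType}.
Local Notation C := R[i].
Implicit Types (x y : l2 R) (w : nat -> C).

Lemma sqnormcJ (c : C) : c * c^* = (sqnormc c)%:C%C.
Proof. by rewrite sqnormcE normCK. Qed.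

Lemma sqnorm_sum L w : sqnorm L w = (\sum_(j < L) sqnormc (w j))%:C%C.
Proof. by rewrite /sqnorm rmorph_sum; apply: eq_bigr => j _; rewrite sqnormcJ. Qed.

Lemma l2_summable x : cvgn (series (fun k => sqnormc (x k))).
Proof. by case: x => x xl; exact: (set_mem xl). Qed.

Lemma l2_norm_ge0 x : 0 <= l2_norm x. Proof. exact: sqrtr_ge0. Qed.

Lemma l2_norm_sqr x : l2_norm x ^+ 2 = limn (series (fun k => sqnormc (x k))).
Proof.
rewrite sqr_sqrtr//; apply: limr_ge; first exact: l2_summable.
by apply: nearW => N; apply: sumr_ge0 => k _; exact: sqnormc_ge0.
Qed.

Lemma l2_partial_le x N : \sum_(j < N) sqnormc (x j) <= l2_norm x ^+ 2.
Proof.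
rewrite l2_norm_sqr -(big_mkord xpredT (fun j => sqnormc (x j))).
apply: (nondecreasing_cvgn_le (u_ := series (fun k => sqnormc (x k)))).
  by apply: nondecreasing_series => k _ _; exact: sqnormc_ge0.
exact: l2_summable.
Qed.

Lemma l2B x y j : (x - y) j = x j - y j.
Proof. by []. Qed.

(** A combination of basis vectors rather than a cut-off sequence, so that linearity of [T] and its
    matrix entries apply directly. *)
Definition truncation w (L : nat) : l2 R := \sum_(k < L) w k *: l2_basis k.

Lemma l2_sum_coord (I : Type) (r : seq I) (c : I -> C) (y : I -> l2 R) j :
  (\sum_(i <- r) c i *: y i) j = \sum_(i <- r) c i * y i j.
Proof. by elim/big_rec2: _ => // i u v _ <-. Qed.

Lemma truncationE w L j : truncation w L j = if (j < L)%N then w j else 0.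
Proof.
rewrite l2_sum_coord; case: ltnP => jL.
  rewrite (bigD1 (Ordinal jL))//= eqxx mulr1 big1 ?addr0// => k /negP kj.
  by case: eqP => [e|]; rewrite ?mulr0//; exfalso; apply: kj; rewrite -val_eqE/= e.
by rewrite big1// => k _ /=; rewrite gtn_eqF ?mulr0//; exact: leq_trans jL.
Qed.

Lemma limn_finite_series (V : pseudoMetricNormedZmodType C) (f : nat -> V) L :
  (forall k, (L <= k)%N -> f k = 0) -> limn (series f) = \sum_(k < L) f k.
Proof.
move=> f0; apply: cvg_lim => //; apply: cvg_near_cst.
exists L => // N /= LN; rewrite /series/= big_mkord.
by apply: sum_widen => // k /andP[Lk _]; exact: f0.
Qed.

Lemma l2_dot_finite x y L : (forall k, (L <= k)%N -> y k = 0) ->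
  l2_dot x y = \sum_(k < L) x k * (y k)^*.
Proof.
move=> y0; apply: (@limn_finite_series C^o) => k Lk.
by rewrite y0// conjC0 mulr0.
Qed.

Lemma l2_dot_basis x j : l2_dot x (l2_basis j) = x j.
Proof.
rewrite (@l2_dot_finite _ _ j.+1) => [|k jk]; last by rewrite /= gtn_eqF.
rewrite big_ord_recr/= eqxx conjC1 mulr1 big1 ?add0r// => k _.
by rewrite ltn_eqF// conjC0 mulr0.
Qed.

Lemma sqr_l2_norm_truncation w L :
  l2_norm (truncation w L) ^+ 2 = \sum_(j < L) sqnormc (w j).
Proof.
rewrite l2_norm_sqr; apply: cvg_lim => //; apply: cvg_near_cst.
exists L => // N /= LN; rewrite /series/= big_mkord.
rewrite (@sum_widen _ L N (fun j => sqnormc (truncation w L j)))//.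
  by apply: eq_bigr => j _; rewrite truncationE ltn_ord.
by move=> k /andP[Lk _]; rewrite truncationE ltnNge Lk /sqnormc/= expr0n addr0.
Qed.

End FiniteVectors.

Section PairingBounds.
Context {R : realType}.
Local Notation C := R[i].

Lemma Re_pairing_bound (t : R) (u v : C) : 0 < t ->
  `|complex.Re (u * v^*)| <= (t^-1 * sqnormc u + t * sqnormc v) / 2.
Proof.
move=> t0; case: u v => [u1 u2] [v1 v2]; rewrite /sqnormc /=.
have := sqr_ge0 (u1 - t * v1); have := sqr_ge0 (u2 - t * v2).
have := sqr_ge0 (u1 + t * v1); have := sqr_ge0 (u2 + t * v2) => h1 h2 h3 h4.
rewrite (_ : _ / 2 = (u1 ^+ 2 + u2 ^+ 2 + t ^+ 2 * (v1 ^+ 2 + v2 ^+ 2)) / (2 * t)).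
  have t2 : 0 < 2 * t by rewrite mulr_gt0.
  rewrite ler_norml -mulNr ler_pdivrMr// ler_pdivlMr//.
  by apply/andP; split; lra.
by field; rewrite gt_eqF.
Qed.

Lemma Im_pairing_bound (t : R) (u v : C) : 0 < t ->
  `|complex.Im (u * v^*)| <= (t^-1 * sqnormc u + t * sqnormc v) / 2.
Proof.
move=> t0; have := Re_pairing_bound ('i * u) v t0.
case: u v => [u1 u2] [v1 v2]; rewrite -complexiE /sqnormc /=.
rewrite !(mul0r, mul1r, sub0r, add0r) sqrrN [u2 ^+ 2 + _]addrC.
by congr (_ <= _); rewrite -normrN; congr `|_|; ring.
Qed.

Lemma Re_sum (I : Type) (r : seq I) (F : I -> C) :
  complex.Re (\sum_(i <- r) F i) = \sum_(i <- r) complex.Re (F i).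
Proof. by elim/big_rec2: _ => // i x [y1 y2] _ <-; case: (F i). Qed.

Lemma Im_sum (I : Type) (r : seq I) (F : I -> C) :
  complex.Im (\sum_(i <- r) F i) = \sum_(i <- r) complex.Im (F i).
Proof. by elim/big_rec2: _ => // i x [y1 y2] _ <-; case: (F i). Qed.

Lemma pairing_bound (t A B : R) L (x y : nat -> C) : 0 < t ->
  \sum_(j < L) sqnormc (x j) <= A -> \sum_(j < L) sqnormc (y j) <= B ->
  let s := \sum_(j < L) x j * (y j)^* in
  `|complex.Re s| <= (t^-1 * A + t * B) / 2 /\
  `|complex.Im s| <= (t^-1 * A + t * B) / 2.
Proof.
move=> t0 xA yB s.
suff h : \sum_(j < L) (t^-1 * sqnormc (x j) + t * sqnormc (y j)) / 2 <=
    (t^-1 * A + t * B) / 2.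
  rewrite /s Re_sum Im_sum; split; apply: le_trans (ler_norm_sum _ _ _) _;
    apply: le_trans h; apply: ler_sum => j _;
    [exact: Re_pairing_bound|exact: Im_pairing_bound].
rewrite -mulr_suml big_split/= -!mulr_sumr ler_pM2r ?invr_gt0//.
by apply: lerD; rewrite ler_pM2l// invr_gt0.
Qed.

Lemma cvg_complex (f : nat -> C^o) (l1 l2 : R) :
  (fun k => complex.Re (f k)) @ \oo --> l1 ->
  (fun k => complex.Im (f k)) @ \oo --> l2 ->
  f @ \oo --> (Complex l1 l2 : C^o).
Proof.
move=> /cvgr_dist_lt f1 /cvgr_dist_lt f2; apply/cvgrPdist_lt => -[e e'].
rewrite ltcE/= => /andP[/eqP -> e0].
have e20 : 0 < e / 2 by exact: divr_gt0.
near=> k.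
have h1 : `|l1 - complex.Re (f k)| < e / 2 by near: k; exact: f1.
have h2 : `|l2 - complex.Im (f k)| < e / 2 by near: k; exact: f2.
rewrite [X in `|X|](_ : _ =
    (l1 - complex.Re (f k))%:C%C + 'i * (l2 - complex.Im (f k))%:C%C).
  apply: le_lt_trans (ler_normD _ _) _; rewrite normrM normCi mul1r.
  rewrite !normc_def/= !expr0n !addr0 !sqrtr_sqr -rmorphD/=.
  by rewrite -[X in _ < X]/(e%:C%C) ltcR [ltRHS]splitr ltrD.
rewrite -complexiE; case: (f k) => x y /=; apply/eqP; rewrite eq_complex/=.
by apply/andP; split; apply/eqP; ring.
Unshelve. all: by end_near. Qed.

End PairingBounds.

Section ToeplitzOperator.
Context {R : realType}.
Local Notation C := R[i].
Variables (T : {linear l2 R -> l2 R}) (B : R) (a : int -> int -> C).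
Hypothesis TB : forall x, l2_norm (T x) <= B * l2_norm x.
Hypothesis Ta : toeplitz_entries a T.
Implicit Types (x y : l2 R) (w : nat -> C).

Lemma toeplitz_truncation w L (j : nat) :
  T (truncation w L) j = \sum_(k < L) a (k%:Z - j%:Z) j%:Z * w k.
Proof.
rewrite /truncation linear_sum; under eq_bigr do rewrite linearZ.
rewrite l2_sum_coord; apply: eq_bigr => k _.
by rewrite -Ta l2_dot_basis mulrC.
Qed.

Lemma band_form_truncation w L :
  band_form a L w w = \sum_(j < L) T (truncation w L) j * (w j)^*.
Proof.
by apply: eq_bigr => j _; rewrite toeplitz_truncation mulr_suml.
Qed.

Lemma sqr_norm_bound x : l2_norm (T x) ^+ 2 <= B ^+ 2 * l2_norm x ^+ 2.
Proof.
rewrite -exprMn ler_sqr ?nnegrE ?TB ?l2_norm_ge0//.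
exact: le_trans (l2_norm_ge0 _) (TB _).
Qed.

Lemma fin_range_sub : fin_range a `<=` plane_set (numerical_range T).
Proof.
move=> _ [L [w [w1 ->]]]; exists (truncation w L).
  apply/eqP; rewrite -(@eqrXn2 _ 2)// ?l2_norm_ge0// expr1n.
  by rewrite sqr_l2_norm_truncation; move: w1; rewrite sqnorm_sum => -[->].
rewrite (@l2_dot_finite _ _ _ L) => [|k Lk]; last by rewrite truncationE ltnNge Lk.
rewrite /form_point/= band_form_truncation [LHS](_ : _ = band_form a L w w); last first.
  by rewrite band_form_truncation; case: (\sum_(j < L) _).
rewrite band_form_truncation; apply: eq_bigr => j _.
by rewrite truncationE ltn_ord.
Qed.

Lemma fin_range_bounded : exists D : R, forall p, fin_range a p ->
  `|p.1| <= D /\ `|p.2| <= D.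
Proof.
(* The bound of [pairing_bound] at [t = 1], for a unit vector and an image of squared norm at most
   [B ^+ 2]. *)
exists ((1^-1 * (B ^+ 2 * 1) + 1 * 1) / 2) => _ [L [w [w1 ->]]].
have w1' : \sum_(j < L) sqnormc (w j) = 1 by move: w1; rewrite sqnorm_sum => -[].
rewrite /form_point/= band_form_truncation; apply: pairing_bound => //.
  apply: le_trans (l2_partial_le _ _) _; apply: le_trans (sqr_norm_bound _) _.
  by rewrite sqr_l2_norm_truncation w1'.
by rewrite w1'.
Qed.

(* In particular [l2_dot], defined by a total [limn], is a genuine limit. *)
Lemma l2_dot_cvg x y :
  (fun N => complex.Re (\sum_(j < N) x j * (y j)^*)) @ \oo --> complex.Re (l2_dot x y) /\
  (fun N => complex.Im (\sum_(j < N) x j * (y j)^*)) @ \oo --> complex.Im (l2_dot x y).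
Proof.
pose g k : R := (1^-1 * sqnormc (x k) + 1 * sqnormc (y k)) / 2.
have g0 k : 0 <= g k.
  by rewrite /g divr_ge0// addr_ge0// mulr_ge0 ?sqnormc_ge0// invr_ge0.
have cg : cvgn (series g).
  rewrite (_ : g = 2^-1 *: ((fun k => sqnormc (x k)) + (fun k => sqnormc (y k)))).
    by apply: is_cvg_seriesZ; apply: is_cvg_seriesD; exact: l2_summable.
  by apply/funext => k; rewrite /g invr1 !mul1r mulrC.
have c1 : cvgn (series (fun k => complex.Re (x k * (y k)^*))).
  apply: normed_cvg; apply: series_le_cvg cg => [k|//|k]; first exact: normr_ge0.
  exact: (Re_pairing_bound (x k) (y k) ltr01).
have c2 : cvgn (series (fun k => complex.Im (x k * (y k)^*))).
  apply: normed_cvg; apply: series_le_cvg cg => [k|//|k]; first exact: normr_ge0.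
  exact: (Im_pairing_bound (x k) (y k) ltr01).
have e1 : series (fun k => complex.Re (x k * (y k)^*)) =
    fun N => complex.Re (\sum_(j < N) x j * (y j)^*).
  by apply/funext => N; rewrite Re_sum /series/= big_mkord.
have e2 : series (fun k => complex.Im (x k * (y k)^*)) =
    fun N => complex.Im (\sum_(j < N) x j * (y j)^*).
  by apply/funext => N; rewrite Im_sum /series/= big_mkord.
rewrite e1 in c1; rewrite e2 in c2.
have -> : l2_dot x y =
    Complex (limn (fun N => complex.Re (\sum_(j < N) x j * (y j)^*)))
            (limn (fun N => complex.Im (\sum_(j < N) x j * (y j)^*))).
  rewrite /l2_dot [series _](_ : _ = fun N => \sum_(j < N) x j * (y j)^* : C^o); last first.
    by apply/funext => N; rewrite /series/= big_mkord.
  apply: (@cvg_lim C^o); first exact: norm_hausdorff.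
  exact: cvg_complex.
by split; [exact: c1|exact: c2].
Qed.

(* The form of [truncation x N] tends to the form of [x] as [N] grows: the error
   pairs [T (x - truncation x N)] with [x], and AM-GM with weight [t] avoids
   Cauchy-Schwarz. *)
Lemma numerical_range_half_plane u v mu z :
  (forall p, fin_range a p -> u * p.1 + v * p.2 <= mu) ->
  numerical_range T z -> u * complex.Re z + v * complex.Im z <= mu.
Proof.
move=> hmu [x x1 ->].
pose s N := \sum_(j < N) sqnormc (x j).
pose S N := \sum_(j < N) T x j * (x j)^*.
have s_cvg : s @ \oo --> (1 : R).
  have <- : limn s = 1.
    rewrite -(expr1n R 2) -x1 l2_norm_sqr; congr (limn _).
    by apply/funext => N; rewrite /series/= big_mkord.
  have : cvgn (series (fun k => sqnormc (x k))) by exact: l2_summable.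
  by rewrite (_ : series _ = s)//; apply/funext => N; rewrite /series/= big_mkord.
have tailE N : l2_norm (x - truncation x N) ^+ 2 = 1 - s N.
  rewrite l2_norm_sqr; apply: cvg_lim => //.
  have : (fun k => s k - s N) @ \oo --> 1 - s N by apply: cvgB => //; exact: cvg_cst.
  apply: cvg_trans; apply: near_eq_cvg; exists N => // k /= Nk.
  rewrite [RHS](_ : _ = \sum_(j < k) sqnormc (x j - truncation x N j)); last first.
    by rewrite seriesEord.
  rewrite /s -(subnKC Nk) !big_split_ord/= addrAC subrr add0r.
  rewrite [X in _ = X + _]big1 ?add0r => [|j _].
    by apply: eq_bigr => j _; rewrite truncationE ltnNge leq_addr subr0.
  by rewrite truncationE ltn_ord subrr /sqnormc/= expr0n addr0.
(* The truncation has squared norm [s N], so by homogeneity its form contributes at most [mu * s N];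
   the rest bounds the error. *)
have step (t : R) N : 0 < t -> u * complex.Re (S N) + v * complex.Im (S N) <=
    mu * s N + (`|u| + `|v|) * ((t^-1 * (B ^+ 2 * (1 - s N)) + t * 1) / 2).
  move=> t0; set E := (_ + t * 1) / 2.
  pose err := \sum_(j < N) T (x - truncation x N) j * (x j)^*.
  have SE : S N = band_form a N x x + err.
    rewrite band_form_truncation /err -big_split/=; apply: eq_bigr => j _.
    by rewrite linearB l2B; ring.
  have [e1 e2] : `|complex.Re err| <= E /\ `|complex.Im err| <= E.
    apply: pairing_bound => //.
      apply: le_trans (l2_partial_le _ _) _; apply: le_trans (sqr_norm_bound _) _.
      by rewrite tailE.
    by apply: le_trans (l2_partial_le _ _) _; rewrite x1 expr1n.
  have formN : u * complex.Re (band_form a N x x) + v * complex.Im (band_form a N x x)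
      <= mu * s N.
    have sE : complex.Re (sqnorm N x) = s N by rewrite sqnorm_sum.
    have [S0|S0] := eqVneq (sqnorm N x) 0.
      by rewrite (band_form_eq0 a S0) -sE S0/= !mulr0 addr0.
    have [p ap ->] := form_point_scale a S0; rewrite sE mulrC ler_wpM2r ?hmu//.
    by apply: sumr_ge0 => j _; exact: sqnormc_ge0.
  have uE : u * complex.Re err <= `|u| * E.
    by apply: le_trans (ler_norm _) _; rewrite normrM ler_wpM2l.
  have vE : v * complex.Im err <= `|v| * E.
    by apply: le_trans (ler_norm _) _; rewrite normrM ler_wpM2l.
  rewrite SE; case: (band_form a N x x) (err) formN uE vE => f1 f2 [g1 g2] /=; lra.
have [c1 c2] := l2_dot_cvg (T x) x.
(* For fixed [t] the tail [1 - s N] tends to [0], which leaves a term linear in [t] that is made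
   arbitrarily small afterwards. *)
have lim_le (t : R) : 0 < t ->
    u * complex.Re (l2_dot (T x) x) + v * complex.Im (l2_dot (T x) x) <=
    mu + (`|u| + `|v|) * (t / 2).
  move=> t0.
  have cl : (fun N => u * complex.Re (S N) + v * complex.Im (S N)) @ \oo -->
      u * complex.Re (l2_dot (T x) x) + v * complex.Im (l2_dot (T x) x).
    by apply: cvgD; apply: cvgMr.
  have cr : (fun N =>
      mu * s N + (`|u| + `|v|) * ((t^-1 * (B ^+ 2 * (1 - s N)) + t * 1) / 2))
      @ \oo --> mu + (`|u| + `|v|) * (t / 2).
    rewrite [X in _ --> X](_ : _ =
      mu * 1 + (`|u| + `|v|) * ((t^-1 * (B ^+ 2 * (1 - 1)) + t * 1) / 2)); last first.
      by rewrite subrr !mulr0 add0r !mulr1.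
    apply: cvgD; first exact: cvgMr.
    apply: cvgMr; apply: cvgMl; apply: cvgD; last exact: cvg_cst.
    do 2 apply: cvgMr; apply: cvgB => //; exact: cvg_cst.
  by apply: ler_cvg_to cl cr _; apply: nearW => N; exact: step.
apply/ler_addgt0Pr => e e0.
have K0 : 0 < `|u| + `|v| + 1 by rewrite ltr_wpDl// addr_ge0.
apply: le_trans (lim_le (e / (`|u| + `|v| + 1)) _) _; first exact: divr_gt0.
rewrite lerD2l; set c := `|u| + `|v| in K0 *.
rewrite (_ : c * _ = e * (c / (2 * (c + 1)))); last by field; rewrite gt_eqF.
rewrite ger_pMr// ler_pdivrMr ?mulr_gt0// mul1r; lra.
Qed.

End ToeplitzOperator.

Theorem theorem3p1 (R : realType) (n m : nat) (T : {linear l2 R -> l2 R})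
    (Tbounded : bounded_operator T)
    (Ttoeplitz : periodic_banded_toeplitz n m T) :
  exists2 g : {poly {poly R}}, g != 0 &
    forall x y : R,
      boundary (plane_set (numerical_range T)) (x, y) -> g.[x%:P].[y] = 0.
Proof.
have [B TB] := Tbounded; have [a [pa ba] Ta] := Ttoeplitz.
have bM : banded (m * n.+1) a by move=> r j rm; apply: ba; lia.
have [D aD] := fin_range_bounded TB Ta.
have [g g0 hg] := thin_support_points pa bM aD.
exists g => // x y [cl nint]; apply: hg; split; last first.
  move=> u v mu hmu.
  pose H := [set q : R * R | u * q.1 + v * q.2 <= mu].
  have cH : closed H.
    apply: (@preimage_closed _ _ (fun q : R * R => u * q.1 + v * q.2)
      [set r | r <= mu]).
      move=> q _; apply: cvgD; apply: cvgMr; [exact: cvg_fst|exact: cvg_snd].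
    exact: closed_le.
  apply: (cH (x, y)); apply: closure_subset cl => q Wq.
  exact: (numerical_range_half_plane TB Ta hmu Wq).
(* A ball around the point inside the finite range would lie in [W(T)] and make the point interior,
   so a supporting line exists. *)
apply: (@separation_plane R (fin_range a) (x, y)).
  by move=> q r t aq ar; exact: (fin_range_convex pa bM aq ar).
move=> [e e0 he]; apply: nint; apply/nbhs_ballP; exists e => // q [q1 q2].
by apply: (fin_range_sub Ta); apply: he; rewrite distrC.
Qed.
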